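(* Assume (H1) and (H2), and that $f$ is continuous at the point $x\in\mathbb{R}^d$. Then the sequence $\big(f_n(x)-f(x)\big)_{n\ge1}$ satisfies an LDP with speed $\big(\sum_{i=1}^n h_i^d\big)$ and rate function $I_x$.
   Context: Let $X_1,X_2,\dots$ be i.i.d. $\mathbb{R}^d$-valued random vectors with bounded probability density $f$, let $(h_n)$ be a positive bandwidth sequence and $K:\mathbb{R}^d\to\mathbb{R}$ a kernel. The recursive kernel density estimator is $f_n(x)=\frac1n\sum_{i=1}^n h_i^{-d}K\big((x-X_i)/h_i\big)$. (H1): $K$ is bounded and integrable, $\int_{\mathbb{R}^d}K(z)dz=1$, and $K(z)\to0$ as $\|z\|\to\infty$. (H2): $h_n=cn^{-a}$ with $c>0$ and $0<a<1/d$. Rate function: with $a$ from (H2), $\psi(u)=\int_{[0,1]\times\mathbb{R}^d}s^{-ad}\big(e^{s^{ad}\frac{u}{1-ad}K(z)}-1\big)ds\,dz$ and $I(t)=\sup_{u\in\mathbb{R}}\{ut-\psi(u)\}$. If $f(x)\neq0$, $I_x(t)=f(x)(1-ad)\,I\Big(\frac{1}{1-ad}+\frac{t}{f(x)(1-ad)}\Big)$; if $f(x)=0$, $I_x(0)=0$ and $I_x(t)=+\infty$ for $t\ne0$. A sequence $(Z_n)$ of real random variables satisfies an LDP with speed $(\nu_n)$ (positive, nondecreasing, $\nu_n\to\infty$) and good rate function $J:\mathbb{R}\to[0,\infty]$ (compact level sets) if for every Borel set $B$: $-\inf_{\mathrm{int}B}J\le\liminf_n\nu_n^{-1}\log\mathbb{P}[Z_n\in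 B]\le\limsup_n\nu_n^{-1}\log\mathbb{P}[Z_n\in B]\le-\inf_{\overline B}J$. *)

(* Defs.v *)
(* R^d is modelled as [d.-tuple R] with its library
   product sigma-algebra (generated by the coordinate maps = Borel sets of R^d). *)
From HB Require Import structures.
From mathcomp Require Import all_boot all_order all_algebra.
From mathcomp Require Import all_classical all_reals all_analysis.
Import Order.TTheory GRing.Theory Num.Theory.
Import numFieldNormedType.Exports.

Set Implicit Arguments.
Unset Strict Implicit.
Unset Printing Implicit Defensive.

Local Open Scope classical_set_scope.
Local Open Scope ring_scope.

Section Defs.
Variable R : realType.

Definition vsub d (x y : d.-tuple R) : d.-tuple R :=
  [tuple tnth x i - tnth y i | i < d].
Definition vscale d (r : R) (x : d.-tuple R) : d.-tuple R :=
  [tuple r * tnth x i | i < d].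
(* sup-norm (all norms on R^d are equivalent) *)
Definition supnorm d (x : d.-tuple R) : R := \big[Num.max/0]_(i < d) `|tnth x i|.

Definition box d (a b : d.-tuple R) : set (d.-tuple R) :=
  [set z | forall i, tnth a i <= tnth z i < tnth b i].
(* lam is Lebesgue measure on the Borel sets of R^d: it gives every box its volume
   (this determines lam uniquely on the product sigma-algebra). *)
Definition is_lebesgue_tuple d (lam : {measure set (d.-tuple R) -> \bar R}) :=
  forall a b : d.-tuple R, (forall i, tnth a i <= tnth b i) ->
    lam (box a b) = (\prod_(i < d) (tnth b i - tnth a i))%:E.

Definition continuous_at_tuple d (f : d.-tuple R -> R) (x : d.-tuple R) :=
  forall e, 0 < e -> exists2 delta, 0 < delta &
    forall y, supnorm (vsub y x) < delta -> `|f y - f x| < e.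

Definition kernel_H1 d (lam : {measure set (d.-tuple R) -> \bar R})
    (K : d.-tuple R -> R) :=
  [/\ exists M : R, forall z, `|K z| <= M,
      lam.-integrable setT (EFin \o K),
      (\int[lam]_z (K z)%:E = 1%:E)%E &
      forall e, 0 < e -> exists M : R, forall z, M < supnorm z -> `|K z| < e].

Definition mutually_independent d0 (Omega : measurableType d0)
    (P : probability Omega R) d' (T : measurableType d') (X : nat -> Omega -> T) :=
  forall (s : seq nat) (A : nat -> set T), uniq s ->
    (forall i, i \in s -> measurable (A i)) ->
    P [set w | forall i, i \in s -> A i (X i w)] =
      (\prod_(i <- s) P (X i @^-1` A i))%E.

Definition has_density d0 (Omega : measurableType d0) (P : probability Omega R)
    d (lam : {measure set (d.-tuple R) -> \bar R})
    (Y : Omega -> d.-tuple R) (f : d.-tuple R -> R) :=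
  forall A, measurable A -> P (Y @^-1` A) = (\int[lam]_(z in A) (f z)%:E)%E.

(* recursive kernel estimator f_n(x) = 1/n sum_{i=1}^n h_i^{-d} K((x - X_i)/h_i),
   where the i-th observation X_i is [X i.-1] (X is 0-indexed). *)
Definition rke d0 (Omega : measurableType d0) d (K : d.-tuple R -> R)
    (h : nat -> R) (X : nat -> Omega -> d.-tuple R) (n : nat)
    (x : d.-tuple R) (w : Omega) : R :=
  n%:R^-1 * \sum_(i < n) (h i.+1 ^+ d)^-1 * K (vscale (h i.+1)^-1 (vsub x (X i w))).

Definition good_rate_function (J : R -> \bar R) :=
  (forall t, 0 <= J t)%E /\ forall alpha : R, compact [set t | (J t <= alpha%:E)%E].

Definition LDP d0 (Omega : measurableType d0) (P : probability Omega R)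
    (Z : nat -> Omega -> R) (nu : nat -> R) (J : R -> \bar R) :=
  [/\ (forall n, 0 < nu n), nondecreasing_seq nu, nu @ \oo --> +oo,
      good_rate_function J &
      forall B : set R, measurable B ->
        (- ereal_inf (J @` interior B) <=
           limn_einf (fun n => (nu n)^-1%:E * lne (P (Z n @^-1` B))))%E /\
        (limn_esup (fun n => (nu n)^-1%:E * lne (P (Z n @^-1` B))) <=
           - ereal_inf (J @` closure B))%E].

Definition psi d (lam : {measure set (d.-tuple R) -> \bar R}) (a : R)
    (K : d.-tuple R -> R) (u : R) : \bar R :=
  (\int[(@lebesgue_measure R \x lam)%E]_(p in `[0%R, 1%R] `*` [set: d.-tuple R])
     ((p.1 `^ (- (a * d%:R))) *
        (expR (p.1 `^ (a * d%:R) * (u / (1 - a * d%:R)) * K p.2) - 1))%:E)%E.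

Definition Irate d (lam : {measure set (d.-tuple R) -> \bar R}) (a : R)
    (K : d.-tuple R -> R) (t : R) : \bar R :=
  ereal_sup [set ((u * t)%:E - psi lam a K u)%E | u in [set: R]].

Definition Ix d (lam : {measure set (d.-tuple R) -> \bar R}) (a : R)
    (K : d.-tuple R -> R) (fx : R) (t : R) : \bar R :=
  if fx != 0 then
    ((fx * (1 - a * d%:R))%:E *
      Irate lam a K ((1 - a * d%:R)^-1 + t / (fx * (1 - a * d%:R))))%E
  else if t == 0 then 0%E else +oo%E.

End Defs.

(* Main.v *)
(** By the Gartner-Ellis argument the LDP follows once the normalised log-Laplace
    transforms [nu_n^-1 ln E exp (nu_n u Z_n)] converge to a finite differentiable
    [Lambda u], and the rate function is then the Legendre transform of [Lambda].
    By independence and the substitution [y = x - h_i z], each observation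
    contributes [ln (1 + h_i^d G_i)], where
    [G_i = \int (exp (u w K z) - 1) f (x - h_i z) dz] and
    [w = nu_n / (n h_i^d) = rho_n (i / n)^(ad)] with [rho_n --> 1 / (1 - ad)].
    Boundedness of [K] and [f] linearises the logarithm, dominated convergence
    replaces [f (x - h_i z)] by [f x], and a weighted Cesaro mean absorbs the errors.
    What remains is a Riemann sum of
    [s |-> s^(-ad) \int (exp (s^(ad) u K z / (1 - ad)) - 1) dz], which is monotone in
    [s] because slopes of the exponential are, so that
    [Lambda u = - u f x + f x (1 - ad) psi u].
    As [Lambda >= 0 = Lambda 0], neither convexity of [Lambda] nor exponential
    tightness has to be invoked. *)

Require Import Defs.
From HB Require Import structures.
From mathcomp Require Import all_boot all_order all_algebra.
From mathcomp Require Import all_classical all_reals all_analysis.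
From mathcomp Require Import measurable_realfun zify ring lra.
Import Order.TTheory GRing.Theory Num.Theory.
Import numFieldNormedType.Exports.
Local Open Scope classical_set_scope.
Local Open Scope ring_scope.

Set Implicit Arguments.
Unset Strict Implicit.
Unset Printing Implicit Defensive.

(** * Large deviations from convergence of log-Laplace transforms *)

(** The sign of [Lam] replaces convexity and tightness as follows. If the rate has a positive
    infimum over [closure B], that closure misses 0, and any slope [v] with [v * y - Lam v > 0] has
    the sign of [y]. So the Chernoff bound at the point of [closure B] nearest to 0 on one side
    controls the whole half-line beyond it, bounded or not. For the lower bound, the law tilted by
    [expR (nu n * (u * Z n w))] concentrates at the derivative of [Lam] at [u] by differentiability
    alone; it remains to find such derivatives near every point of finite rate. The sign itself
    comes from [1 + y <= expR y] and the unit integral of [K], once the estimator is centred at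
    [f x]. For the estimator the obstacle is that the exponents form a triangular array, depending
    on both [n] and [i]. Two uniformities remove it: the exponents stay in a fixed bounded interval,
    and the error from replacing the shifted density by [f x] is bounded by a quantity depending on
    [i] only, so that it can be averaged. *)

Section ereal_bounds.
Context (R : realType).
Implicit Types (u : nat -> \bar R) (i S : \bar R).

Lemma limn_esup_le_near u i : (\forall n \near \oo, (u n <= i)%E) ->
  (limn_esup u <= i)%E.
Proof.
move=> ui; rewrite /limn_esup /limf_esup.
apply: le_trans (_ : ereal_sup (u @` [set n | (u n <= i)%E]) <= i)%E.
  by apply: ereal_inf_lbound; exists [set n | (u n <= i)%E].
by apply/ge_ereal_sup => _ [n /= un <-].
Qed.

Lemma limn_einf_ge_near u i : (\forall n \near \oo, (i <= u n)%E) ->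
  (i <= limn_einf u)%E.
Proof.
move=> ui; rewrite /limn_einf leeNr; apply: limn_esup_le_near.
by apply: filterS ui => n; rewrite leeN2.
Qed.

(** Reduces the upper bound to real levels below the infimum, so that an infinite infimum is treated
    like a finite one. *)
Lemma le_oppe_of_lt S i : (forall l : R, (l%:E < i)%E -> (S <= (- l)%:E)%E) ->
  (S <= - i)%E.
Proof.
case: i => [r| |] H; last by rewrite leey.
- apply/lee_addgt0Pr => e e0; rewrite -EFinN -EFinD.
  by apply: le_trans (H (r - e) _) _; rewrite ?lte_fin ?lee_fin; lra.
- rewrite leeNy_eq; apply/eqP/eqe_oppP => /=.
  apply/eqyP => A A0; rewrite leeNr -EFinN.
  by apply: le_trans (H A _) _; rewrite ?ltry// lee_fin.
Qed.

End ereal_bounds.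

Section gartner_ellis.
Context (R : realType) (d0 : measure_display) (Omega : measurableType d0)
  (P : probability Omega R).
Variables (Z : nat -> Omega -> R) (nu : nat -> R) (L : nat -> R -> R)
  (Lam : R -> R).
Hypothesis mZ : forall n, measurable_fun setT (Z n).
Hypothesis nu_gt0 : forall n, 0 < nu n.
Hypothesis nu_nd : nondecreasing_seq nu.
Hypothesis nu_oo : nu @ \oo --> +oo.
Hypothesis mgfE : forall n u,
  (\int[P]_w (expR (nu n * (u * Z n w)))%:E = (expR (nu n * L n u))%:E)%E.
Hypothesis L_cvg : forall u, L n u @[n --> \oo] --> Lam u.
Hypothesis Lam_ge0 : forall u, 0 <= Lam u.
Hypothesis Lam0 : Lam 0 = 0.
Hypothesis Lam_diff : forall u, derivable Lam u 1.

Definition legendre (t : R) : \bar R :=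
  ereal_sup [set (u * t - Lam u)%:E | u in [set: R]].

Lemma legendre_ge u t : ((u * t - Lam u)%:E <= legendre t)%E.
Proof. by apply: ereal_sup_ubound; exists u. Qed.

Lemma legendre_ge0 t : (0 <= legendre t)%E.
Proof. by have := legendre_ge 0 t; rewrite mul0r Lam0 subr0. Qed.

Lemma legendre_0 : legendre 0 = 0%E.
Proof.
apply/eqP; rewrite eq_le legendre_ge0 andbT.
by apply/ge_ereal_sup => _ [u _ <-]; rewrite mulr0 sub0r lee_fin oppr_le0.
Qed.

Lemma measurable_tilt D n u v : measurable_fun D
  (EFin \o (fun w => expR (nu n * (u * Z n w - v)))).
Proof.
apply: measurable_funS (subsetT D) _ => //.
apply/measurable_EFinP; apply: measurableT_comp => //.
apply: measurable_funM => //; apply: measurable_funB => //.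
exact: measurable_funM.
Qed.

Lemma measurable_tilt0 D n u : measurable_fun D
  (EFin \o (fun w => expR (nu n * (u * Z n w)))).
Proof.
have := @measurable_tilt D n u 0; apply: eq_measurable_fun => w _ /=.
by rewrite subr0.
Qed.

Lemma measurable_halfspace n (v b : R) : measurable [set w | v * b <= v * Z n w].
Proof.
rewrite -[X in measurable X]setTI.
by apply: measurable_fun_le => //; exact: measurable_funM.
Qed.

(** On the half-line the factor [expR (nu n * (v * Z n w - v * b))] is at least 1, and multiplying
    by it changes the tilt from [u] to [u + v]. The sign of [v] selects the direction of the
    half-line; [u = 0] is the usual Chernoff bound, other [u] bound the tails of a tilted law. *)
Lemma tilted_chernoff n (u v b : R) :
  (\int[P]_(w in [set w | (v * b <= v * Z n w)%R]) (expR (nu n * (u * Z n w)))%:E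
   <= (expR (nu n * (L n (u + v) - v * b)))%:E)%E.
Proof.
set A := [set w | _].
have mA : measurable A by exact: measurable_halfspace.
have m1 v' D : measurable_fun D (fun w => (expR (nu n * (v' * Z n w)))%:E).
  exact: measurable_tilt0.
have m2 D : measurable_fun D (fun w => (expR (nu n * ((u + v) * Z n w - v * b)))%:E).
  exact: measurable_tilt.
apply: (@le_trans _ _ (\int[P]_(w in A) (expR (nu n * ((u + v) * Z n w - v * b)))%:E)%E).
  apply: ge0_le_integral => // w; rewrite /A/= => Aw.
  by rewrite lee_fin ler_expR ler_pM2l//; lra.
apply: (@le_trans _ _ (\int[P]_w (expR (nu n * ((u + v) * Z n w - v * b)))%:E)%E).
  by apply: ge0_subset_integral => // w _; rewrite lee_fin expR_ge0.
under eq_integral do rewrite mulrBr addrC expRD EFinM.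
rewrite ge0_integralZl//.
rewrite mgfE -EFinM -expRD lee_fin ler_expR; lra.
Qed.

Lemma chernoff_halfspace n (v b : R) :
  (P [set w | (v * b <= v * Z n w)%R] <= (expR (- (nu n * (v * b - L n v))))%:E)%E.
Proof.
have := tilted_chernoff n 0 v b.
rewrite add0r -[L n v - _]opprB mulrN.
under eq_integral do rewrite mul0r mulr0 expR0.
by rewrite integral_cst ?mul1e//; exact: measurable_halfspace.
Qed.

(** A level set is an intersection of closed half-lines, one for each slope; slopes 1 and -1, where
    [Lam] is finite, already bound it. *)
Lemma good_legendre : good_rate_function legendre.
Proof.
split; first exact: legendre_ge0.
move=> al; have H u t : (legendre t <= al%:E)%E -> u * t - Lam u <= al.
  by move=> /(le_trans (legendre_ge u t)); rewrite lee_fin.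
apply: (@subclosed_compact _ _ `[- (al + Lam (-1)), al + Lam 1]%classic).
- have -> : [set t | (legendre t <= al%:E)%E] =
      \bigcap_(u in [set: R]) [set t | u * t <= al + Lam u].
    apply/seteqP; split => [t /= tal u _ /=|t /= tal].
      by have := H u t tal; lra.
    apply/ge_ereal_sup => _ [u _ <-]; rewrite lee_fin.
    by have := tal u I; rewrite /=; lra.
  apply: closed_bigI => u _.
  apply: (@closed_comp _ _ ( *%R u) [set x | x <= al + Lam u]).
    by move=> t _; exact: mulrl_continuous.
  exact: closed_le.
- exact: segment_compact.
- move=> t /= tal; rewrite in_itv/=.
  by have := H 1 t tal; have := H (-1) t tal; lra.
Qed.

Lemma near_nu_ge M : \forall n \near \oo, M <= nu n.
Proof. by move: nu_oo => /cvgryPge. Qed.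

Lemma near_halfspace_le (v b l : R) : l < v * b - Lam v ->
  \forall n \near \oo,
    (P [set w | (v * b <= v * Z n w)%R] <= (expR (- (nu n * l)))%:E)%E.
Proof.
move=> lv.
have Ll : \forall n \near \oo, L n v < v * b - l.
  by apply: cvgr_lt (@L_cvg v) _ _; lra.
apply: filterS Ll => n Ln; apply: le_trans (chernoff_halfspace n v b) _.
by rewrite lee_fin ler_expR lerN2 ler_pM2l//; lra.
Qed.


(** The rate vanishes at 0, so 0 lies outside [closure B] and [B] is covered by two half-lines, one
    on each side; the factor 2 is the union bound. *)
Lemma ldp_upper_near (B : set R) (l : R) : measurable B -> 0 <= l ->
  (l%:E < ereal_inf (legendre @` closure B))%E ->
  \forall n \near \oo, (P (Z n @^-1` B) <= (2 * expR (- (nu n * l)))%:E)%E.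
Proof.
move=> mB l0 lB.
have Bl y : closure B y -> exists u, l < u * y - Lam u.
  move=> By; have : (l%:E < legendre y)%E.
    by apply: lt_le_trans lB _; apply: ereal_inf_lbound; exists y.
  by move=> /ereal_sup_gt[_ [u _ <-]]; rewrite lte_fin => ?; exists u.
have B0 : ~ closure B 0.
  by move=> /Bl[u]; rewrite mulr0 sub0r; have := Lam_ge0 u; lra.
(* For each of the two half-lines, the point of [closure B] closest to 0
   yields a Chernoff exponent larger than [l]. *)
have side (s : R) : s = 1 \/ s = -1 -> exists v b, l < v * b - Lam v /\
    forall z, B z -> 0 <= s * z -> v * b <= v * z.
  move=> s1.
  pose F := [set t | closure B (s * t) /\ 0 <= t].
  have ss : s * s = 1 by case: s1 => ->; lra.
  have clF : closed F.
    apply: closedI; last exact: closed_ge.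
    apply: (@closed_comp _ _ ( *%R s) (closure B)); last exact: closed_closure.
    by move=> t _; exact: mulrl_continuous.
  have [[t Ft]|F0] := pselect (F !=set0); last first.
    (* Nothing of [B] lies on this side: the covering condition is vacuous and any pair with
       exponent above [l] will do. *)
    exists 1, (l + 1 + Lam 1); split=> [|z Bz sz]; first lra.
    exfalso; apply: F0; exists (s * z); split => //.
    by rewrite mulrA ss mul1r; exact: subset_closure.
  have Finf : has_inf F by split; [exists t|exists 0 => ? []].
  have Fi : F (inf F).
    apply: itv_closed_infimums => //; first by exists t.
    split; first by move=> y Fy; apply: ge_inf => //; exact: Finf.2.
    by move=> y yF; apply: lb_le_inf => //; exact: Finf.1.
  set i := inf F in Fi.
  have i0 : 0 < i.
    rewrite lt_neqAle Fi.2 andbT; apply/eqP => i0.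
    by apply: B0; move: Fi.1; rewrite -i0 mulr0.
  have [v lv] := Bl _ Fi.1.
  exists v, (s * i); split => // z Bz sz.
  have iz : i <= s * z.
    apply: ge_inf; first exact: Finf.2.
    by split => //; rewrite mulrA ss mul1r; exact: subset_closure.
  (* Since [Lam v] and [l] are nonnegative, [v * (s * i)] is positive: the tilt points away from 0,
     so its half-space contains everything beyond [s * i]. *)
  have vs : 0 < v * s.
    have := Lam_ge0 v; rewrite -(pmulr_lgt0 _ i0) -mulrA; lra.
  rewrite mulrA; have -> : v * z = (v * s) * (s * z) by rewrite mulrA -(mulrA v) ss mulr1.
  by rewrite ler_pM2l.
have [v1 [b1 [lv1 H1]]] := side 1 (or_introl erefl).
have [v2 [b2 [lv2 H2]]] := side (-1) (or_intror erefl).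
near=> n.
apply: (@le_trans _ _ (P ([set w | (v1 * b1 <= v1 * Z n w)%R] `|`
    [set w | (v2 * b2 <= v2 * Z n w)%R]))%E).
  apply: le_measure; rewrite ?inE.
  - by rewrite -[X in measurable X]setTI; exact: mZ.
  - by apply: measurableU; exact: measurable_halfspace.
  - move=> w /= Bw; have [Z0|Z0] := leP 0 (Z n w).
      by left; apply: H1 => //; rewrite mul1r.
    by right; apply: H2 => //; lra.
apply: (@le_trans _ _ (P [set w | (v1 * b1 <= v1 * Z n w)%R] +
    P [set w | (v2 * b2 <= v2 * Z n w)%R])%E).
  by apply: measureU2; exact: measurable_halfspace.
rewrite mulrDl mul1r EFinD; apply: leeD.
- by near: n; exact: near_halfspace_le.
- by near: n; exact: near_halfspace_le.
Unshelve. all: by end_near. Qed.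

Lemma ldp_upper (B : set R) : measurable B ->
  (limn_esup (fun n => (nu n)^-1%:E * lne (P (Z n @^-1` B))) <=
   - ereal_inf (legendre @` closure B))%E.
Proof.
move=> mB; have mZB n : measurable (Z n @^-1` B).
  by rewrite -[X in measurable X]setTI; exact: mZ.
apply: le_oppe_of_lt => l lB.
have [l0|l0] := leP 0 l; last first.
  apply: limn_esup_le_near; apply: nearW => n.
  apply: (@le_trans _ _ 0%E); last by rewrite lee_fin; lra.
  apply: mule_ge0_le0; first by rewrite lee_fin invr_ge0 ltW.
  by rewrite lne_le0 probability_le1.
apply/lee_addgt0Pr => e e0; apply: limn_esup_le_near.
(* The factor 2 costs [ln 2 / nu n], which is at most [e] once [nu n] reaches [ln 2 / e]. *)
have Bn := ldp_upper_near mB l0 lB.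
have nue := near_nu_ge (ln 2 / e).
near=> n.
have P2 : (P (Z n @^-1` B) <= (2 * expR (- (nu n * l)))%:E)%E by near: n.
have n2 : ln 2 / e <= nu n by near: n.
rewrite muleC lee_pdivrMr// ?invr_gt0//.
apply: (@le_trans _ _ (lne (2 * expR (- (nu n * l)))%:E)).
  by rewrite lee_lne// in_itv/= leey andbT// lee_fin mulr_ge0// expR_ge0.
rewrite lne_EFin ?mulr_gt0 ?expR_gt0// lnM ?posrE ?expR_gt0// expRK.
rewrite -EFinD -EFinM lee_fin.
have : ln 2 <= nu n * e by rewrite -ler_pdivrMr.
lra.
Unshelve. all: by end_near. Qed.


(* Minimising [Lam t - t y + eps t^2 / 2] moves [y] to a nearby derivative of
   [Lam] at no cost; this makes convexity of [Lam] unnecessary. *)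
Lemma legendre_exposed (y I delta : R) : legendre y = I%:E -> 0 < delta ->
  exists (u y' : R), [/\ is_derive u 1 Lam y', `|y' - y| < delta &
    - I <= Lam u - u * y'].
Proof.
move=> yI delta0.
have I0 : 0 <= I by rewrite -lee_fin -yI legendre_ge0.
have LI t : - I <= Lam t - t * y.
  by have := legendre_ge t y; rewrite yI lee_fin; lra.
move: yI => _.
(* At the minimiser, [F u <= F 0 = 0] gives [eps / 2 * u ^+ 2 <= I], hence [(eps * u) ^+ 2 <= 2 *
   eps * I < delta ^+ 2]; and [eps * u] is the distance by which the derivative misses [y]. *)
pose eps := delta ^+ 2 / (4 * (I + 1)).
have eps0 : 0 < eps by rewrite divr_gt0// ?exprn_gt0//; lra.
have epsE : eps * (I + 1) = delta ^+ 2 / 4 by rewrite /eps; field; lra.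
pose F t := Lam t - t * y + eps / 2 * t ^+ 2.
have dF (t : R) : is_derive t 1 F ('D_1 Lam t - y + eps * t).
  have dL : is_derive t 1 Lam ('D_1 Lam t) by exact: derivableP.
  rewrite /F; apply: is_derive_eq.
  by rewrite scaler0 /GRing.scale/=; field.
(* Chosen so that the penalty at [M] is [2 * (I + 1)], which outweighs the lower bound [- I] and
   makes [F] positive outside [[-M, M]]. *)
pose M := 4 * (I + 1) / delta.
have M0 : 0 < M by rewrite divr_gt0//; lra.
have epsM : eps / 2 * M ^+ 2 = 2 * (I + 1).
  by rewrite /eps /M; field; apply/andP; split; lra.
have F0 : F 0 = 0 by rewrite /F Lam0 mul0r expr0n/= mulr0; lra.
have [u uM Fmin] : exists2 u, u \in `[-M, M]%R &
    forall t, t \in `[-M, M]%R -> F u <= F t.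
  apply: EVT_min; first lra.
  by apply: derivable_within_continuous => t _.
have Fu0 : F u <= 0 by rewrite -F0; apply: Fmin; rewrite in_itv/=; lra.
have Fmin' t : F u <= F t.
  have [tM|tM] := boolP (t \in `[-M, M]%R); first exact: Fmin.
  apply: le_trans Fu0 _; rewrite /F.
  have := LI t; suff : eps / 2 * M ^+ 2 <= eps / 2 * t ^+ 2 by lra.
  rewrite ler_pM2l; last lra.
  rewrite -[leRHS]real_normK ?num_real// ler_sqr ?nnegrE//; last exact: ltW.
  rewrite leNgt; apply: contra tM; rewrite ltr_norml in_itv/= => /andP[? ?].
  by apply/andP; split; exact: ltW.
(* The minimum is global, so any open interval around [u] serves, wherever [u] lies in [[-M, M]]. *)
have du0 : is_derive u 1 F 0.
  apply: (@derive1_at_min _ F (u - 1) (u + 1) u) => //; first lra.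
  by rewrite in_itv/=; lra.
have D0 : 'D_1 Lam u - y + eps * u = 0.
  by rewrite -(@derive_val _ _ _ _ _ _ _ (dF u)) (@derive_val _ _ _ _ _ _ _ du0).
have eu2 : (eps * u) ^+ 2 < delta ^+ 2.
  have h1 : eps / 2 * u ^+ 2 <= I by have := LI u; move: Fu0; rewrite /F; lra.
  have h2 : eps * (eps / 2 * u ^+ 2) <= eps * I by rewrite ler_pM2l.
  have h3 : 0 < delta ^+ 2 by rewrite exprn_gt0.
  rewrite exprMn expr2; move: h2 epsE; nra.
exists u, ('D_1 Lam u); split; first exact: derivableP.
- have -> : 'D_1 Lam u - y = - (eps * u) by lra.
  rewrite normrN -(ger0_norm (ltW delta0)) -ltr_sqr ?nnegrE//.
  by rewrite !real_normK ?num_real.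
- have -> : 'D_1 Lam u = y - eps * u by lra.
  have := LI u; have : 0 <= eps * u ^+ 2 by rewrite mulr_ge0 ?sqr_ge0// ltW.
  by rewrite expr2; lra.
Qed.

Lemma is_derive_two_sided (g : R -> R) (u y' del : R) : is_derive u 1 g y' -> 0 < del ->
  exists2 v, 0 < v & g (u + v) - g u - v * y' <= v * del /\
    g (u - v) - g u + v * y' <= v * del.
Proof.
move=> dg del0.
have : h^-1 *: (g (h *: 1 + u) - g u) @[h --> 0^'] --> y'.
  by have := @derive_val _ _ _ _ _ _ _ dg => <-; exact: (@ex_derive _ _ _ _ _ _ _ dg).
move=> /cvgrPdist_le/(_ _ del0)[e /= e0 H].
exists (e / 2); first by rewrite divr_gt0.
have e2 : 0 < e / 2 by rewrite divr_gt0.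
split.
- have /= := H (e / 2); rewrite /ball_/= sub0r normrN gtr0_norm//.
  move=> /(_ _ _)/wrap[]; [by lra|by rewrite gt_eqF|].
  rewrite /GRing.scale/= mulr1 [e / 2 + u]addrC ler_norml => /andP[+ _].
  rewrite lerBrDl -(ler_pM2l e2) => {H}.
  by rewrite mulrDr mulrA divff ?gt_eqF// mul1r; lra.
- have /= := H (- (e / 2)); rewrite /ball_/= sub0r opprK gtr0_norm//.
  move=> /(_ _ _)/wrap[]; [by lra|by rewrite lt_eqF// oppr_lt0|].
  rewrite /GRing.scale/= mulr1 [- (e / 2) + u]addrC ler_norml => /andP[_ +].
  rewrite -(ler_pM2l e2) => {H}.
  by rewrite mulrBr mulrA invrN mulrN divff ?gt_eqF// mulN1r; lra.
Qed.

(** The tilted law puts at least half of its mass near [y']. Each tail is bounded by tilting a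
    further [v] or [- v]; for small [v] the gain [v * del] beats the first-order error [v * del / 2]
    of [Lam], so each tail keeps at most a quarter. *)
Lemma tilted_mass_near (u y' del : R) : is_derive u 1 Lam y' -> 0 < del ->
  \forall n \near \oo,
   ((2^-1 * expR (nu n * L n u))%:E <=
   \int[P]_(w in [set w | `|Z n w - y'| < del]%R) (expR (nu n * (u * Z n w)))%:E)%E.
Proof.
move=> dL del0.
have [v v0 [v1 v2]] := is_derive_two_sided dL (divr_gt0 del0 (ltr0Sn _ 1)).
(* The limiting tail exponents are at most [- (v * del / 2)]; half of that margin absorbs the
   convergence of [L n]. *)
pose kap := v * del / 4.
have kap0 : 0 < kap by rewrite divr_gt0// mulr_gt0.
have c1 : \forall n \near \oo, L n (u + v) - v * (y' + del) - L n u < - kap.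
  have : L n (u + v) - v * (y' + del) - L n u @[n --> \oo] -->
      Lam (u + v) - v * (y' + del) - Lam u.
    by apply: cvgB => //; apply: cvgB => //; exact: cvg_cst.
  by move=> /cvgr_lt; apply; rewrite /kap; nra.
have c2 : \forall n \near \oo, L n (u - v) + v * (y' - del) - L n u < - kap.
  have : L n (u - v) + v * (y' - del) - L n u @[n --> \oo] -->
      Lam (u - v) + v * (y' - del) - Lam u.
    by apply: cvgB => //; apply: cvgD => //; exact: cvg_cst.
  by move=> /cvgr_lt; apply; rewrite /kap; nra.
have c3 := near_nu_ge (ln 4 / kap).
near=> n.
have c3' : expR (- (nu n * kap)) <= 4^-1.
  rewrite -[leRHS]lnK ?posrE// ler_expR lnV ?posrE// lerN2.
  by rewrite -(@ler_pdivrMr R)//; near: n.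
have m1 D : measurable_fun D (fun w => (expR (nu n * (u * Z n w)))%:E).
  exact: measurable_tilt0.
set C := [set w | _].
set A1 := [set w | v * (y' + del) <= v * Z n w].
set A2 := [set w | - v * (y' - del) <= - v * Z n w].
have mA1 : measurable A1 by exact: measurable_halfspace.
have mA2 : measurable A2 by exact: measurable_halfspace.
have CE : C = ~` (A1 `|` A2).
  apply/seteqP; split => w; rewrite /C /A1 /A2 /=.
    rewrite ltr_norml !mulNr lerN2 !ler_pM2l// => /andP[? ?] []; lra.
  move=> /not_orP[]; rewrite !mulNr lerN2 !ler_pM2l// => /negP + /negP.
  by rewrite -!ltNge ltr_norml; lra.
have mC : measurable C by rewrite CE; apply/measurableC/measurableU.
have exp0 w : (0 <= (expR (nu n * (u * Z n w)))%:E)%E by rewrite lee_fin expR_ge0.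
have tot : ((expR (nu n * L n u))%:E <=
   \int[P]_(w in C) (expR (nu n * (u * Z n w)))%:E +
   (\int[P]_(w in A1) (expR (nu n * (u * Z n w)))%:E +
    \int[P]_(w in A2) (expR (nu n * (u * Z n w)))%:E))%E.
  rewrite -mgfE -(setUv C) ge0_integral_setU//; [|exact: measurableC|exact/disj_setPCl].
  rewrite leeD2l// CE setCK ge0_integral_setU//.
  apply/disj_setPS => w []; rewrite /A1 /A2 /= !mulNr lerN2 !ler_pM2l//; lra.
have i1 : (\int[P]_(w in A1) (expR (nu n * (u * Z n w)))%:E <=
    (4^-1 * expR (nu n * L n u))%:E)%E.
  apply: le_trans (tilted_chernoff n u v (y' + del)) _.
  have c1' : L n (u + v) - v * (y' + del) - L n u < - kap by near: n.
  rewrite lee_fin; apply: le_trans (ler_wpM2r (expR_ge0 _) c3').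
  rewrite -expRD ler_expR.
  by have := ler_wpM2l (ltW (nu_gt0 n)) (ltW c1'); lra.
have i2 : (\int[P]_(w in A2) (expR (nu n * (u * Z n w)))%:E <=
    (4^-1 * expR (nu n * L n u))%:E)%E.
  apply: le_trans (tilted_chernoff n u (- v) (y' - del)) _.
  have c2' : L n (u - v) + v * (y' - del) - L n u < - kap by near: n.
  rewrite lee_fin; apply: le_trans (ler_wpM2r (expR_ge0 _) c3').
  rewrite -expRD ler_expR.
  by have := ler_wpM2l (ltW (nu_gt0 n)) (ltW c2'); lra.
have : ((expR (nu n * L n u))%:E <= \int[P]_(w in C) (expR (nu n * (u * Z n w)))%:E
    + (2^-1 * expR (nu n * L n u))%:E)%E.
  apply: le_trans tot _; rewrite leeD2l//; apply: le_trans (leeD i1 i2) _.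
  by rewrite -EFinD lee_fin; lra.
move: i1 i2 tot => _ _ _.
rewrite -leeBlDr// -EFinB; apply: le_trans; rewrite lee_fin; lra.
Unshelve. all: by end_near. Qed.

Lemma ldp_lower_point (B : set R) (y : R) : measurable B -> interior B y ->
  (- legendre y <= limn_einf (fun n => (nu n)^-1%:E * lne (P (Z n @^-1` B))))%E.
Proof.
move=> mB /nbhs_ballP[r /= r0 rB].
have mZB n : measurable (Z n @^-1` B).
  by rewrite -[X in measurable X]setTI; exact: mZ.
have := legendre_ge0 y; case E : (legendre y) => [I| |] // _; last by rewrite leNye.
have [u [y' [dL yy' LuI]]] := legendre_exposed E (divr_gt0 r0 (ltr0Sn _ 1)).
move: E => _.
apply/lee_subgt0Pr => e e0.
(* The first term keeps the window around [y'] inside the ball of radius [r] around [y], the second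
   keeps [u * Z n w] within [e / 2] of [u * y']. The rest of [e] is split evenly between the
   convergence of [L n u] and the factor [2^-1]. *)
pose del := Num.min (r / 2) (e / (2 * (`|u| + 1))).
have u1 : 0 < 2 * (`|u| + 1) by have := normr_ge0 u; lra.
have del0 : 0 < del by rewrite lt_min divr_gt0//= divr_gt0.
have udel : `|u| * del <= e / 2.
  have : del <= e / (2 * (`|u| + 1)) by rewrite ge_min lexx orbT.
  by rewrite ler_pdivlMr//; have := normr_ge0 u; nra.
have Ln : \forall n \near \oo, Lam u - e / 4 < L n u.
  by apply: cvgr_gt (@L_cvg u) _ _; lra.
have mass := tilted_mass_near dL del0.
have nue := near_nu_ge (4 * ln 2 / e).
apply: limn_einf_ge_near; near=> n.
have Ln' : Lam u - e / 4 < L n u by near: n.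
have nue' : ln 2 <= nu n * (e / 4).
  have : 4 * ln 2 / e <= nu n by near: n.
  by rewrite ler_pdivrMr//; lra.
have mC : measurable [set w | `|Z n w - y'| < del]%R.
  rewrite (_ : [set w | _] = Z n @^-1` ball y' del); last first.
    by apply/seteqP; split=> w; rewrite /ball/= distrC.
  by rewrite -[X in measurable X]setTI; apply: mZ => //; exact: measurable_ball.
have CB : [set w | `|Z n w - y'| < del]%R `<=` Z n @^-1` B.
  move=> w /= Cw; apply: rB; rewrite /ball/= distrC.
  have : del <= r / 2 by rewrite ge_min lexx.
  have := ler_distD y' (Z n w) y; lra.
(* Undoing the tilt: on the window the weight is at most [expR (nu n * (u * y' + e / 2))], so the
   tilted mass bounds the probability from below. *)
have low : ((2^-1 * expR (nu n * (L n u - u * y' - e / 2)))%:E <= P (Z n @^-1` B))%E.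
  apply: (@le_trans _ _ (P [set w | `|Z n w - y'| < del]%R)); last first.
    by apply: le_measure; rewrite ?inE.
  have : ((2^-1 * expR (nu n * L n u))%:E <=
   \int[P]_(w in [set w | `|Z n w - y'| < del]%R) (expR (nu n * (u * Z n w)))%:E)%E.
    by near: n.
  move=> /le_trans.
  move=> /(_ ((expR (nu n * (u * y' + e / 2)))%:E *
      P [set w | `|Z n w - y'| < del]%R)%E).
  have -> : 2^-1 * expR (nu n * (L n u - u * y' - e / 2)) =
     (2^-1 * expR (nu n * L n u)) / expR (nu n * (u * y' + e / 2)).
    by rewrite -expRN -mulrA -expRD; congr (_ * expR _); lra.
  move=> le2; rewrite EFinM muleC lee_pdivrMl ?expR_gt0//; apply: le2.
  rewrite -integral_cst//; apply: ge0_le_integral => //.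
  - exact: measurable_tilt0.
  - move=> w /= Cw; rewrite lee_fin ler_expR ler_pM2l//.
    have : u * (Z n w - y') <= `|u| * del.
      apply: le_trans (ler_norm _) _; rewrite normrM ler_wpM2l//; exact: ltW.
    lra.
apply: (@le_trans _ _ ((nu n)^-1%:E *
    lne (2^-1 * expR (nu n * (L n u - u * y' - e / 2)))%:E)%E); last first.
  rewrite lee_wpmul2l ?lee_fin ?invr_ge0 ?(ltW (nu_gt0 n))//.
  by rewrite lee_lne// in_itv/= leey andbT// lee_fin mulr_ge0 ?invr_ge0 ?expR_ge0.
move: low => _; rewrite lne_EFin ?mulr_gt0 ?expR_gt0// lnM ?posrE ?expR_gt0//.
rewrite expRK lnV ?posrE// -EFinM -EFinN -EFinD lee_fin -(ler_pM2l (nu_gt0 n)).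
rewrite mulrA divff ?gt_eqF// mul1r.
suff : nu n * (- I - e) <= nu n * (- (e / 4) + (L n u - u * y' - e / 2)) by lra.
by rewrite ler_pM2l//; lra.
Unshelve. all: by end_near. Qed.

Theorem gartner_ellis_ldp : LDP P Z nu legendre.
Proof.
split => //; first exact: good_legendre.
move=> B mB; split; last exact: ldp_upper.
rewrite leeNl; apply: le_ereal_inf_tmp => _ [y By <-].
by rewrite leeNl; exact: ldp_lower_point.
Qed.

End gartner_ellis.

(** * Densities and independence *)

Definition image_measure d d' (T1 : measurableType d) (T2 : measurableType d')
    (R : realType) (m : {measure set T1 -> \bar R}) (f : T1 -> T2)
    (mf : measurable_fun setT f) : {measure set T2 -> \bar R} :=
  measure_function_pushforward__canonical__measure_function_Measure m mf.

Section density_integral.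
Local Open Scope ereal_scope.
Context d1 d2 (T1 : measurableType d1) (T2 : measurableType d2) (R : realType).
Variables (m1 : {measure set T1 -> \bar R}) (m2 : {measure set T2 -> \bar R}).
Variables (Y : T2 -> T1) (W : T2 -> R).
Hypotheses (mY : measurable_fun setT Y) (mW : measurable_fun setT W).
Hypothesis W0 : forall w, (0 <= W w)%R.
Hypothesis m1E : forall A, measurable A -> m1 A = \int[m2]_(w in Y @^-1` A) (W w)%:E.

Import HBNNSimple.

(** One statement for two uses: [Y := id] and [W := f] for a law with a density, and [Y := X n] with
    a partial product as weight for the induction on independent factors. It passes from sets to
    simple functions to monotone limits. *)
Lemma ge0_integral_density (g : T1 -> \bar R) : measurable_fun setT g ->
  (forall t, 0 <= g t) -> \int[m1]_t g t = \int[m2]_w (g (Y w) * (W w)%:E).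
Proof.
move=> mg g0.
pose g_ := nnsfun_approx measurableT mg.
have mYA A : measurable A -> measurable (Y @^-1` A).
  by move=> mA; rewrite -[X in measurable X]setTI; exact: mY.
transitivity (limn (fun n => \int[m1]_t (g_ n t)%:E)).
  rewrite -monotone_convergence//.
  - apply: eq_integral => y _; apply/esym/cvg_lim => //.
    by apply: cvg_nnsfun_approx.
  - by move=> n; exact/measurable_EFinP/measurable_funP.
  - by move=> n y _; rewrite lee_fin.
  - by move=> y _ m n mn; rewrite lee_fin; exact/lefP/nd_nnsfun_approx.
have mgY n : measurable_fun setT (fun w => (g_ n (Y w))%:E * (W w)%:E).
  apply: emeasurable_funM; last exact/measurable_EFinP.
  apply/measurable_EFinP; exact: (measurableT_comp (measurable_funP (g_ n))).
transitivity (limn (fun n => \int[m2]_w ((g_ n (Y w))%:E * (W w)%:E))); last first.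
  rewrite -monotone_convergence//.
  - apply: eq_integral => w _; apply/cvg_lim => //.
    by apply: cvgeZr => //; exact: cvg_nnsfun_approx.
  - by move=> n w _; rewrite mule_ge0// lee_fin.
  - move=> w _ m n mn; rewrite lee_wpmul2r ?lee_fin//.
    exact/lefP/nd_nnsfun_approx.
congr (limn _); apply/funext => n.
transitivity (\sum_(k \in range (g_ n)) k%:E * m1 (g_ n @^-1` [set k])).
  by rewrite integralT_nnsfun sintegralE.
under eq_fsbigr do rewrite m1E//.
have m1k k : measurable (g_ n @^-1` [set k]) by [].
transitivity (\int[m2]_w (\sum_(k \in range (g_ n))
    (k * \1_(g_ n @^-1` [set k]) (Y w))%:E * (W w)%:E)); last first.
  apply: eq_integral => w _; rewrite [in RHS]fimfunE -fsumEFin//.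
  by rewrite ge0_mule_fsuml// => k; exact: nnfun_muleindic_ge0.
rewrite ge0_integral_fsum//; last 2 first.
- move=> k; apply: emeasurable_funM; last exact/measurable_EFinP.
  apply/measurable_EFinP; apply: measurable_funM => //.
  exact: (@measurableT_comp _ _ _ _ _ _ (\1_(g_ n @^-1` [set k]) : T1 -> R) _ Y).
- move=> k w _; apply: mule_ge0; last by rewrite lee_fin.
  by rewrite EFinM; exact: nnfun_muleindic_ge0.
apply: eq_fsbigr => k /set_mem [t _ gtk].
have k0 : (0 <= k)%R by rewrite -gtk.
rewrite integral_mkcond -ge0_integralZl//; last 2 first.
- apply/(measurable_restrictT _ _).1 => //; [exact: mYA|].
  by apply/measurable_EFinP; exact: measurable_funTS.
- by move=> w _; rewrite patchE; case: ifPn => // _; rewrite lee_fin.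
apply: eq_integral => w _; rewrite patchE indicE EFinM -muleA.
have [wk|wk] := boolP (w \in Y @^-1` (g_ n @^-1` [set k])).
  by rewrite (_ : (Y w \in _) = true) ?mul1e//; move: wk; rewrite !inE.
rewrite (_ : (Y w \in _) = false) ?mul0e//; apply/negbTE.
by move: wk; apply: contra; rewrite !inE.
Qed.

End density_integral.

Section independence.
Context (R : realType) d0 (Omega : measurableType d0) (P : probability Omega R)
  d' (T : measurableType d') (X : nat -> Omega -> T).
Hypothesis mX : forall i, measurable_fun setT (X i).
Hypothesis indX : mutually_independent P X.
Variable g : nat -> T -> R.
Hypothesis mg : forall i, measurable_fun setT (g i).
Hypothesis g0 : forall i t, 0 <= g i t.
Hypothesis gfin : forall i, (\int[P]_w (g i (X i w))%:E < +oo)%E.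

Lemma measurable_prod_comp n :
  measurable_fun setT (fun w => \prod_(i < n) g i (X i w)).
Proof.
elim: n => [|n IH].
  by rewrite (_ : (fun w => _) = cst 1)//; apply/funext => w; rewrite big_ord0.
rewrite (_ : (fun w => _) =
  (fun w => (\prod_(i < n) g i (X i w)) * g n (X n w))); last first.
  by apply/funext => w; rewrite big_ord_recr.
by apply: measurable_funM => //; exact: measurableT_comp.
Qed.

(* The indicators of the events [A i (X i w)] are replaced by the [g i] one
   index at a time. *)
Lemma integral_prod_indep_gen n m (A : nat -> set T) :
  (forall i, measurable (A i)) ->
  (\int[P]_(w in [set w | forall i, (n <= i < n + m)%N -> A i (X i w)])
     (\prod_(i < n) g i (X i w))%:E =
   (\prod_(i < n) \int[P]_w (g i (X i w))%:E) *
   (\prod_(n <= i < n + m) P (X i @^-1` A i)))%E.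
Proof.
have mXA i B : measurable B -> measurable (X i @^-1` B).
  by move=> mB; rewrite -[X in measurable X]setTI; exact: mX.
have mE k m' B : (forall i, measurable (B i)) ->
    measurable [set w | forall i, (k <= i < k + m')%N -> B i (X i w)].
  move=> mB; rewrite (_ : [set w | _] =
      \bigcap_(i in [set i | (k <= i < k + m')%N]) (X i @^-1` B i)).
    by apply: bigcap_measurableType => i _; exact: mXA.
  by apply/seteqP; split => w /= H i; exact: H.
elim: n m A => [|n IH] m A mA.
  under eq_integral do rewrite big_ord0.
  rewrite integral_cst ?mul1e//; last exact: mE.
  have := indX (iota_uniq _ _) (fun i (_ : i \in iota 0 m) => mA i).
  rewrite big_ord0 mul1e add0n /index_iota subn0 => <-; congr (P _).
  by apply/seteqP; split => w /= H i; have := H i; rewrite mem_iota.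
set E := [set w | _].
have mEE : measurable E by exact: mE.
pose W w := (\prod_(i < n) g i (X i w)) * \1_E w.
have mW : measurable_fun setT W.
  by apply: measurable_funM => //; exact: measurable_prod_comp.
have W0 w : 0 <= W w by rewrite mulr_ge0// prodr_ge0.
(* The contribution of all indices other than [n]. It must be finite, since a measure is scaled by a
   real number. *)
pose e := ((\prod_(i < n) \int[P]_w (g i (X i w))%:E) *
   (\prod_(n.+1 <= i < n.+1 + m) P (X i @^-1` A i)))%E.
have e0 : (0 <= e)%E.
  rewrite mule_ge0//; apply: prode_ge0 => // i _.
  by apply: integral_ge0 => w _; rewrite lee_fin.
have efin : e \is a fin_num.
  rewrite fin_numM//; last first.
    by apply: prode_fin_num => i _; apply: fin_num_measure; exact: mXA.
  apply: prode_fin_num => i _; rewrite ge0_fin_numE//.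
  by apply: integral_ge0 => w _; rewrite lee_fin.
have fe0 : 0 <= fine e by exact: fine_ge0.
(* With [e] times the law of [X n], the induction hypothesis becomes [m1E], an identity between set
   functions, which then extends from indicators to [g n]. *)
pose m1 : {measure set T -> \bar R} :=
  mscale (NngNum fe0) (image_measure P (mX n)).
have m1E B : measurable B -> m1 B = (\int[P]_(w in X n @^-1` B) (W w)%:E)%E.
  have -> : m1 B = (e * P (X n @^-1` B))%E by rewrite -[in RHS](fineK efin).
  move=> mB.
  (* Treating [B] as the event at index [n] lets the induction hypothesis be used with [m.+1]
     events. *)
  pose A' i := if i == n then B else A i.
  have mA' i : measurable (A' i) by rewrite /A'; case: ifP.
  have -> : (\int[P]_(w in X n @^-1` B) (W w)%:E)%E =
     (\int[P]_(w in [set w | forall i, (n <= i < n + m.+1)%N -> A' i (X i w)])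
       (\prod_(i < n) g i (X i w))%:E)%E.
    have -> : [set w | forall i, (n <= i < n + m.+1)%N -> A' i (X i w)] =
        X n @^-1` B `&` E.
      apply/seteqP; split => w /=.
        move=> H; split; first by have := H n; rewrite /A' eqxx; apply; lia.
        move=> i ni; have := H i; rewrite /A' ifF; first by apply; lia.
        by apply/negbTE; lia.
      move=> [Bw Ew] i ni; rewrite /A'; case: eqP => [->//|/eqP ni'].
      by apply: Ew; lia.
    rewrite integral_mkcondr; apply: eq_integral => w _.
    rewrite /W patchE indicE; case: ifPn => _; first by rewrite mulr1.
    by rewrite mulr0.
  rewrite IH// big_ltn; last lia.
  rewrite /e addnS addSn /A' eqxx -muleA; congr (_ * _)%E.
  rewrite [RHS]muleC; congr (_ * _)%E; symmetry.
  by apply: congr_big_nat => // i ni; rewrite ifF//; apply/negbTE; lia.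
have mgE : measurable_fun setT (EFin \o g n) by exact/measurable_EFinP.
transitivity (\int[P]_w ((g n (X n w))%:E * (W w)%:E))%E.
  rewrite integral_mkcond; apply: eq_integral => w _.
  rewrite patchE /W indicE big_ord_recr/=; case: ifPn => _.
    by rewrite mulr1 -EFinM mulrC.
  by rewrite mulr0 mule0.
rewrite -(@ge0_integral_density _ _ _ _ _ m1 _ _ _ _ _ _ m1E (EFin \o g n))//.
have -> : (\int[m1]_t (EFin \o g n) t = e * \int[P]_w (g n (X n w))%:E)%E.
  transitivity ((fine e)%:E * \int[pushforward P (X n)]_t (EFin \o g n) t)%E.
    by apply: ge0_integral_mscale => // t _; rewrite lee_fin.
  rewrite fineK// ge0_integral_pushforward// ?preimage_setT//.
  by move=> t _; rewrite lee_fin.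
  by rewrite /e big_ord_recr/= muleAC.
by move=> t /=; rewrite lee_fin.
Qed.

Lemma integral_prod_indep n :
  (\int[P]_w (\prod_(i < n) g i (X i w))%:E =
   \prod_(i < n) \int[P]_w (g i (X i w))%:E)%E.
Proof.
have := integral_prod_indep_gen n 0 (fun=> @measurableT _ T).
rewrite addn0 big_geq// mule1 => <-; congr integral.
by apply/esym/seteqP; split => // w _ i; lia.
Qed.

End independence.

(** * Lebesgue measure on tuples *)

Section lebesgue_tuple.
Context (R : realType) (d : nat) (lam : {measure set (d.-tuple R) -> \bar R}).
Hypothesis lamP : is_lebesgue_tuple lam.
Implicit Types (a b z : d.-tuple R).

Lemma normr_tnth_supnorm z i : `|tnth z i| <= supnorm z.
Proof. exact: (le_bigmax _ (fun i => `|tnth z i|)). Qed.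

Lemma boxE a b : box a b = \bigcap_(i in [set: 'I_d])
  ((fun z => tnth z i) @^-1` `[tnth a i, tnth b i[%classic).
Proof.
apply/seteqP; split => z /= H i; first by move=> _ /=; rewrite in_itv/=.
by have := H i I; rewrite /= in_itv.
Qed.

Lemma measurable_box a b : measurable (box a b).
Proof.
rewrite boxE; apply: fin_bigcap_measurable => // i _.
rewrite -[X in measurable X]setTI; exact: measurable_tnth.
Qed.

Lemma box_gt a b i : tnth b i < tnth a i -> box a b = set0.
Proof.
move=> ba; apply/seteqP; split => // z /(_ i) /andP[az zb].
by have := lt_trans zb ba; rewrite ltNge az.
Qed.

Definition cube (k : nat) : set (d.-tuple R) :=
  box [tuple - k%:R | _ < d] [tuple k%:R | _ < d].

Lemma bigcup_cube : \bigcup_k cube k = setT.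
Proof.
apply/seteqP; split => // z _.
exists (Num.bound (supnorm z)) => // i; rewrite !tnth_mktuple.
have : `|tnth z i| < (Num.bound (supnorm z))%:R.
  apply: le_lt_trans (normr_tnth_supnorm z i) _; apply: archi_boundP.
  exact: le_trans (normr_ge0 _) (normr_tnth_supnorm z i).
by rewrite ltr_norml => /andP[/ltW -> ->].
Qed.

Lemma lam_cube_lty k : (lam (cube k) < +oo)%E.
Proof.
rewrite /cube lamP ?ltry// => i; rewrite !tnth_mktuple.
have : (0 : R) <= k%:R by []. 
lra.
Qed.

Lemma lam_sigma_finite : sigma_finite setT lam.
Proof.
exists cube; first by rewrite bigcup_cube.
by move=> k; split; [exact: measurable_box|exact: lam_cube_lty].
Qed.

Lemma box_setI_closed : setI_closed [set A : set (d.-tuple R) | exists a b, A = box a b].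
Proof.
move=> _ _ [a [b ->]] [a' [b' ->]].
exists [tuple Num.max (tnth a i) (tnth a' i) | i < d].
exists [tuple Num.min (tnth b i) (tnth b' i) | i < d].
apply/seteqP; split => z /=.
  move=> [/= H H'] i; rewrite !tnth_mktuple ge_max lt_min.
  by have /andP[-> ->] := H i; have /andP[-> ->] := H' i.
move=> H; split => i; have := H i; rewrite !tnth_mktuple ge_max lt_min.
  by move=> /andP[/andP[-> _] /andP[-> _]].
by move=> /andP[/andP[_ ->] /andP[_ ->]].
Qed.

(** A half-space [tnth z i < y] is a countable union of boxes: cut side [i] at [y] and let the other
    sides grow. *)
Lemma measurable_boxE : @measurable _ (d.-tuple R) =
  <<s [set A : set (d.-tuple R) | exists a b, A = box a b] >>.
Proof.
set G := [set A | _].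
apply/seteqP; split; last first.
  apply: smallest_sub; first exact: sigma_algebra_measurable.
  by move=> _ [a [b ->]]; exact: measurable_box.
apply: smallest_sub; first exact: smallest_sigma_algebra.
suff H (i : 'I_d) : preimage_set_system setT (fun z : d.-tuple R => tnth z i)
    (@measurable _ R) `<=` <<s G >>.
  elim/big_ind: _ => // A B HA HB C [CA|CB]; [exact: HA|exact: HB].
suff : measurable_fun (setT : set (g_sigma_algebraType G))
    (fun z : g_sigma_algebraType G => tnth (z : d.-tuple R) i).
  by move=> mt _ [Y mY <-]; exact: mt.
apply: (measurability _ (RGenInftyO.measurableE R)) => _ [_ [y ->] <-].
rewrite setTI (_ : _ @^-1` _ = \bigcup_k
  box [tuple - k%:R | _ < d] [tuple if j == i then y else k%:R | j < d]).
  apply: bigcupT_measurable => k; apply: sub_sigma_algebra.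
  by eexists; eexists; reflexivity.
apply/seteqP; split => z /=; rewrite in_itv/=.
  move=> zy; have : (setT : set (d.-tuple R)) z by [].
  rewrite -bigcup_cube => -[k _ kz]; exists k => // j.
  have := kz j; rewrite !tnth_mktuple => /andP[-> ?] /=.
  by case: eqP => [->|].
by move=> [k _ /(_ i)]; rewrite !tnth_mktuple eqxx => /andP[].
Qed.

Lemma cvg_prod_ord (u : 'I_d -> nat -> R) (l : 'I_d -> R) :
  (forall i, u i n @[n --> \oo] --> l i) ->
  \prod_(i < d) u i n @[n --> \oo] --> \prod_(i < d) l i.
Proof.
move=> ul; elim: (index_enum _) => [|i s IH].
  rewrite big_nil (_ : (fun n => _) = cst 1); first exact: cvg_cst.
  by apply/funext => n; rewrite big_nil.
rewrite big_cons (_ : (fun n => _) = (fun n => u i n * \prod_(j <- s) u j n)).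
  exact: cvgM.
by apply/funext => n; rewrite big_cons.
Qed.

Definition boxoc a b : set (d.-tuple R) :=
  [set z | forall i, tnth a i < tnth z i <= tnth b i].

(** The substitution [x - r z] reverses each axis, so the preimage of a box is open on the left and
    closed on the right. Its volume follows by squeezing it between boxes of the original kind; the
    [Num.min] keeps the inner one from having crossed endpoints. *)
Lemma lam_boxoc a b : (forall i, tnth a i <= tnth b i) ->
  lam (boxoc a b) = (\prod_(i < d) (tnth b i - tnth a i))%:E.
Proof.
move=> ab.
have mboxoc : measurable (boxoc a b).
  rewrite (_ : boxoc a b = \bigcap_(i in [set: 'I_d])
      ((fun z => tnth z i) @^-1` `]tnth a i, tnth b i]%classic)).
    apply: fin_bigcap_measurable => // i _.
    rewrite -[X in measurable X]setTI; exact: measurable_tnth.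
  apply/seteqP; split => z /= H i; first by move=> _ /=; rewrite in_itv/=.
  by have := H i I; rewrite /= in_itv.
pose V := \prod_(i < d) (tnth b i - tnth a i).
have up n : (lam (boxoc a b) <= (\prod_(i < d) (tnth b i + n.+1%:R^-1 - tnth a i))%:E)%E.
  set e : R := n.+1%:R^-1; have e0 : 0 < e by rewrite invr_gt0.
  have := @lamP a [tuple tnth b i + e | i < d].
  move=> /(_ _)/wrap[].
    by move=> i; rewrite tnth_mktuple; have := ab i; lra.
  under eq_bigr do rewrite tnth_mktuple.
  move=> <-; apply: le_measure; rewrite ?inE//; first exact: measurable_box.
  by move=> z H i; have := H i; rewrite tnth_mktuple; lra.
have lo n : ((\prod_(i < d) (tnth b i - Num.min (tnth a i + n.+1%:R^-1) (tnth b i)))%:E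
    <= lam (boxoc a b))%E.
  set e : R := n.+1%:R^-1; have e0 : 0 < e by rewrite invr_gt0.
  have := @lamP [tuple Num.min (tnth a i + e) (tnth b i) | i < d] b.
  move=> /(_ _)/wrap[].
    by move=> i; rewrite tnth_mktuple ge_min lexx orbT.
  under eq_bigr do rewrite tnth_mktuple.
  move=> <-; apply: le_measure; rewrite ?inE//; first exact: measurable_box.
  move=> z H i; have := H i; rewrite tnth_mktuple ge_min.
  by move=> /andP[/orP[?|?] ?]; lra.
have fin : lam (boxoc a b) \is a fin_num.
  by rewrite ge0_fin_numE//; exact: le_lt_trans (up 0%N) (ltry _).
rewrite -(fineK fin); congr (_%:E).
have inv0 : (n.+1%:R^-1 : R) @[n --> \oo] --> (0 : R) by exact: cvg_harmonic.
apply/eqP; rewrite eq_le; apply/andP; split.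
  have c : \prod_(i < d) (tnth b i + n.+1%:R^-1 - tnth a i) @[n --> \oo] --> V.
    apply: cvg_prod_ord => i; apply: cvgB; last exact: cvg_cst.
    by rewrite -[X in _ --> X]addr0; apply: cvgD => //; exact: cvg_cst.
  rewrite -/V -(cvg_lim _ c)//; apply: limr_ge; first exact: cvgP c.
  by apply: nearW => n; rewrite -lee_fin fineK.
have c : \prod_(i < d) (tnth b i - Num.min (tnth a i + n.+1%:R^-1) (tnth b i))
    @[n --> \oo] --> V.
  apply: cvg_prod_ord => i; apply: cvgB; first exact: cvg_cst.
  apply: (@squeeze_cvgr _ _ _ _ (cst (tnth a i)) (fun n => tnth a i + n.+1%:R^-1)).
  - by apply: nearW => n /=; rewrite le_min ge_min lexx ab/= !andbT lerDl invr_ge0.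
  - exact: cvg_cst.
  - by rewrite -[X in _ --> X]addr0; apply: cvgD => //; exact: cvg_cst.
rewrite -/V -(cvg_lim _ c)//; apply: limr_le; first exact: cvgP c.
by apply: nearW => n; rewrite -lee_fin fineK.
Qed.

Definition affine (x : d.-tuple R) (r : R) z := vsub x (vscale r z).

Lemma measurable_affine x r : measurable_fun setT (affine x r).
Proof.
apply/measurable_fun_tnthP => i.
rewrite (_ : _ \o _ = (fun z => tnth x i - r * tnth z i)).
  apply: measurable_funB => //; apply: measurable_funM => //.
  exact: measurable_tnth.
by apply/funext => z /=; rewrite /affine !tnth_mktuple.
Qed.

Lemma affineK x r : r != 0 -> cancel (affine x r) (fun y => vscale r^-1 (vsub x y)).
Proof.
move=> r0 z; apply: eq_from_tnth => i; rewrite /affine !tnth_mktuple.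
by field.
Qed.

(** Both sides are measures in [A] that agree on boxes, a generating family stable under
    intersection and exhausted by cubes of finite volume. *)
Lemma lam_affine x (r : R) A : 0 < r -> measurable A ->
  lam (affine x r @^-1` A) = (((r ^+ d)^-1)%:E * lam A)%E.
Proof.
move=> r0 mA.
have rd0 : 0 <= (r ^+ d)^-1 by rewrite invr_ge0 exprn_ge0// ltW.
pose m1 : {measure set (d.-tuple R) -> \bar R} := mscale (NngNum rd0) lam.
pose m2 := image_measure lam (measurable_affine x r).
suff H : m1 A = m2 A by exact: esym H.
apply: (measure_unique _ cube measurable_boxE box_setI_closed) => //.
- by move=> i; eexists; eexists; reflexivity.
- exact: bigcup_cube.
- move=> _ [a [b ->]].
  have [ab|] := pselect (forall i, tnth a i <= tnth b i); last first.
    move=> /existsNP[i /negP]; rewrite -ltNge => /box_gt ->.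
    by rewrite !measure0.
  rewrite (_ : m1 _ = ((r ^+ d)^-1%:E * lam (box a b))%E)//.
  rewrite lamP// -EFinM.
  rewrite (_ : m2 _ = lam (boxoc [tuple r^-1 * (tnth x i - tnth b i) | i < d]
      [tuple r^-1 * (tnth x i - tnth a i) | i < d])); last first.
    have E (u v w a0 : R) : (r^-1 * (u - v) < w <= r^-1 * (u - a0)) =
        (a0 <= u - r * w < v).
      rewrite ![r^-1 * _]mulrC ltr_pdivrMr// ler_pdivlMr//.
      by apply/idP/idP => /andP[? ?]; apply/andP; split; lra.
    congr (lam _); apply/seteqP; split => z H i; have := H i.
      by rewrite !tnth_mktuple E.
    by rewrite !tnth_mktuple E.
  rewrite lam_boxoc; last first.
    move=> i; rewrite !tnth_mktuple ler_pM2l ?invr_gt0//.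
    by have := ab i; lra.
  congr (_%:E); rewrite -exprVn -[X in _ ^+ X]card_ord -prodr_const -big_split.
  by apply: eq_bigr => i _ /=; rewrite !tnth_mktuple; lra.
- move=> k; rewrite (_ : m1 _ = ((r ^+ d)^-1%:E * lam (cube k))%E)//.
  by rewrite lte_mul_pinfty// ?lee_fin// lam_cube_lty.
Qed.

Lemma ge0_integral_affine x (r : R) (g : d.-tuple R -> \bar R) : 0 < r ->
  measurable_fun setT g -> (forall y, 0 <= g y)%E ->
  (\int[lam]_y g y = (r ^+ d)%:E * \int[lam]_z g (affine x r z))%E.
Proof.
move=> r0 mg g0.
have rd0 : 0 <= r ^+ d by rewrite exprn_ge0// ltW.
pose m2 := image_measure lam (measurable_affine x r).
pose m1 : {measure set (d.-tuple R) -> \bar R} := mscale (NngNum rd0) m2.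
transitivity (\int[m1]_y g y)%E.
  apply: eq_measure_integral => A mA _.
  rewrite (_ : m1 _ = ((r ^+ d)%:E * lam (affine x r @^-1` A))%E)//.
  by rewrite lam_affine// muleA -EFinM divff ?mul1e// expf_neq0// gt_eqF.
rewrite ge0_integral_mscale//; congr (_ * _)%E.
by rewrite ge0_integral_pushforward//; exact: measurable_affine.
Qed.

(* A copy of [lam] carrying the sigma-finite structure needed by Fubini. *)
Definition tuple_lebesgue of is_lebesgue_tuple lam : set (d.-tuple R) -> \bar R := lam.
HB.instance Definition _ := Measure.copy (tuple_lebesgue lamP) lam.
HB.instance Definition _ := Measure_isSigmaFinite.Build _ _ _ (tuple_lebesgue lamP)
  lam_sigma_finite.

End lebesgue_tuple.

(** * Exponential integrals *)

Section exp_inequalities.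
Context (R : realType).
Implicit Types (c s t y z B : R).

Lemma norm_expR_sub1 y : `|expR y - 1| <= `|y| * expR `|y|.
Proof.
have e1 := expR_ge1Dx y; have e2 := expR_ge1Dx (- y).
have e3 : expR (- y) * expR y = 1 by rewrite -expRD addNr expR0.
have e4 := expR_gt0 y.
have [y0|y0] := leP 0 y.
  rewrite !ger0_norm//; last lra.
  by have := ler_wpM2r (ltW e4) e2; rewrite e3; lra.
rewrite ltr0_norm ?subr_lt0 ?expR_lt1// (ltr0_norm y0).
have : 1 <= expR (- y) by lra.
nra.
Qed.

Lemma norm_expR_sub1_le y B : `|y| <= B -> `|expR y - 1| <= `|y| * expR B.
Proof.
move=> yB; apply: le_trans (norm_expR_sub1 y) _.
by rewrite ler_wpM2l// ler_expR.
Qed.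

(** The exponent collects [B] from factoring out [expR z] and [2 * B] from the difference
    [y - z]. *)
Lemma norm_expR_sub y z B : `|y| <= B -> `|z| <= B ->
  `|expR y - expR z| <= `|y - z| * expR (3 * B).
Proof.
move=> yB zB.
have -> : expR y - expR z = expR z * (expR (y - z) - 1).
  by rewrite mulrBr -expRD mulr1; congr (expR _ - _); lra.
have yzB : `|y - z| <= 2 * B.
  by apply: le_trans (ler_normB _ _) _; lra.
rewrite normrM (gtr0_norm (expR_gt0 _)).
apply: (@le_trans _ _ (expR B * (`|y - z| * expR (2 * B)))); last first.
  rewrite mulrCA -expRD ler_wpM2l// ler_expR; lra.
apply: ler_pM; rewrite ?expR_ge0//.
  by rewrite ler_expR (le_trans (ler_norm _)).
exact: norm_expR_sub1_le.
Qed.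

(** The tangent of the exponential at [s * c], evaluated at [t * c] and at 0 and weighted by [s] and
    [t - s]: the terms linear in [c] cancel. *)
Lemma expR_slope_nd c s t : 0 < s -> s <= t ->
  s^-1 * (expR (s * c) - 1) <= t^-1 * (expR (t * c) - 1).
Proof.
move=> s0 st; have t0 : 0 < t by exact: lt_le_trans st.
rewrite ler_pdivrMl// mulrCA ler_pdivlMl//.
have e1 := expR_ge1Dx ((t - s) * c).
have e2 := expR_ge1Dx (- (s * c)).
have e3 : expR (s * c) * expR ((t - s) * c) = expR (t * c).
  by rewrite -expRD; congr expR; lra.
have e4 : expR (s * c) * expR (- (s * c)) = 1 by rewrite -expRD addrN expR0.
have := ler_wpM2l (expR_ge0 (s * c)) e1; have := ler_wpM2l (expR_ge0 (s * c)) e2.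
rewrite e3 e4 => h1 h2.
have ts : 0 <= t - s by rewrite subr_ge0.
have := ler_wpM2l (ltW s0) h2; have := ler_wpM2l ts h1; lra.
Qed.

(** The logarithm lies between [y / (1 + y)] and [y]; the hypothesis bounds [(1 + y)^-1], so the
    error is quadratic with a uniform constant. *)
Lemma ln1D_sub_le y B : expR (- B) <= 1 + y ->
  `|ln (1 + y) - y| <= expR B * y ^+ 2.
Proof.
move=> By; have y1 : 0 < 1 + y by exact: lt_le_trans (expR_gt0 _) By.
have h1 : ln (1 + y) <= y by apply: le_ln1Dx; lra.
have h2 : y / (1 + y) <= ln (1 + y).
  have := @le_ln1Dx _ ((1 + y)^-1 - 1); rewrite addrCA addrN addr0 => /(_ _)/wrap[].
    by rewrite ltrBrDl addrN invr_gt0.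
  rewrite lnV ?posrE// => h.
  have : y / (1 + y) = 1 - (1 + y)^-1 by field; lra.
  lra.
have h3 : (1 + y)^-1 <= expR B.
  by rewrite -[leRHS]invrK -expRN lef_pV2 ?posrE// expR_gt0.
have h4 : y - y / (1 + y) = (1 + y)^-1 * y ^+ 2 by field; lra.
have h5 : (1 + y)^-1 * y ^+ 2 <= expR B * y ^+ 2 by rewrite ler_wpM2r// sqr_ge0.
by rewrite ler0_norm; lra.
Qed.

End exp_inequalities.

Section phi.
Context (R : realType) d (T : measurableType d) (mu : {measure set T -> \bar R}).
Variables (K : T -> R) (M : R).
Hypothesis KM : forall z, `|K z| <= M.
Hypothesis intK : mu.-integrable setT (EFin \o K).
Implicit Types (w B C v s t : R).

(** Subtracting 1 makes the integrand dominated by a multiple of [|K z|], hence integrable even when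
    [mu] is infinite. *)
Definition phi w : R := \int[mu]_z (expR (w * K z) - 1).
Definition nK : R := \int[mu]_z `|K z|.

Lemma measurable_smoothing_kernel : measurable_fun setT K.
Proof. by apply/measurable_EFinP; exact: measurable_int intK. Qed.

Lemma integrable_normK : mu.-integrable setT (EFin \o (fun z => `|K z|)).
Proof. exact: integrable_abse intK. Qed.

Lemma nK_ge0 : 0 <= nK.
Proof. exact: Rintegral_ge0. Qed.

Lemma measurable_expK w : measurable_fun setT (fun z => expR (w * K z)).
Proof.
apply: measurableT_comp => //; apply: measurable_funM => //.
exact: measurable_smoothing_kernel.
Qed.

Lemma norm_wK w z : `|w * K z| <= `|w| * M.
Proof. by rewrite normrM ler_wpM2l. Qed.

Lemma norm_expK w z : `|expR (w * K z) - 1| <= `|w| * expR (`|w| * M) * `|K z|.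
Proof.
apply: le_trans (norm_expR_sub1_le (norm_wK w z)) _.
by rewrite normrM mulrAC.
Qed.

Lemma integrable_leK (g : T -> R) C : measurable_fun setT g ->
  (forall z, `|g z| <= C * `|K z|) -> mu.-integrable setT (EFin \o g).
Proof.
move=> mg gC.
apply: (@le_integrable _ _ _ mu setT measurableT _ (EFin \o (fun z => C * `|K z|))) => //.
- exact/measurable_EFinP.
- by move=> z _ /=; rewrite lee_fin (le_trans (gC z))// ler_norm.
- exact: integrableZl integrable_normK.
Qed.

Lemma norm_Rintegral_leK (g : T -> R) C : measurable_fun setT g ->
  (forall z, `|g z| <= C * `|K z|) -> `|\int[mu]_z g z| <= C * nK.
Proof.
move=> mg gC; have ig := integrable_leK mg gC.
apply: le_trans (le_normr_Rintegral measurableT ig) _.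
rewrite /nK -RintegralZl//; last exact: integrable_normK.
apply: le_Rintegral => //; first exact: integrable_abse ig.
exact: integrableZl integrable_normK.
Qed.

Lemma integrable_expK w : mu.-integrable setT (EFin \o (fun z => expR (w * K z) - 1)).
Proof.
apply: integrable_leK (norm_expK w).
by apply: measurable_funB => //; exact: measurable_expK.
Qed.

Lemma phi_lipschitz B w w' : `|w| <= B -> `|w'| <= B ->
  `|phi w - phi w'| <= `|w - w'| * expR (3 * (B * M)) * nK.
Proof.
move=> wB wB'.
have M0 (z : T) : 0 <= M by exact: le_trans (normr_ge0 _) (KM z).
rewrite /phi -RintegralB//; try exact: integrable_expK.
apply: norm_Rintegral_leK.
  by apply: measurable_funB; apply: measurable_funB => //; exact: measurable_expK.
move=> z.
rewrite (_ : _ - _ = expR (w * K z) - expR (w' * K z)); last by ring.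
apply: le_trans (norm_expR_sub (_ : _ <= B * M) (_ : _ <= B * M)) _.
- by apply: le_trans (norm_wK _ _) _; rewrite ler_wpM2r// (M0 z).
- by apply: le_trans (norm_wK _ _) _; rewrite ler_wpM2r// (M0 z).
- by rewrite -mulrBl normrM mulrAC.
Qed.

Lemma phi_slope_nd v s t : 0 < s -> s <= t -> s^-1 * phi (s * v) <= t^-1 * phi (t * v).
Proof.
move=> s0 st; rewrite /phi -!RintegralZl//; try exact: integrable_expK.
apply: le_Rintegral => //; try exact: integrableZl (integrable_expK _).
by move=> z _; rewrite -!mulrA; exact: expR_slope_nd.
Qed.

Lemma phi_norm_le w : `|phi w| <= `|w| * expR (`|w| * M) * nK.
Proof.
apply: norm_Rintegral_leK (norm_expK w).
by apply: measurable_funB => //; exact: measurable_expK.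
Qed.

Lemma phi_ge w : w * \int[mu]_z K z <= phi w.
Proof.
rewrite -RintegralZl//; apply: le_Rintegral => //.
- exact: integrableZl intK.
- exact: integrable_expK.
- by move=> z _; have := expR_ge1Dx (w * K z); lra.
Qed.

Lemma phi_derivable (w : R) : derivable phi w 1.
Proof.
apply: (@derivable_under_integral _ _ _ mu (fun w z => expR (w * K z) - 1) setT
  measurableT w (w - 1) (w + 1) _ _ _
  (fun z => expR ((`|w| + 1) * M) * `|K z|)).
- by rewrite /= in_itv/=; lra.
- by move=> w' _; exact: integrable_expK.
- by move=> w' z _ _; exact: ex_derive.
- by move=> z; rewrite mulr_ge0 ?expR_ge0.
- exact: integrableZl integrable_normK.
- move=> w' z; rewrite /= in_itv/= => /andP[w1 w2] _.
  rewrite partial1of2E.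
  have -> : 'D_1 (fun x : R => expR (x * K z) - 1) w' = expR (w' * K z) * K z.
    rewrite derive_val; rewrite /GRing.scale/=; ring.
  rewrite normrM (gtr0_norm (expR_gt0 _)) ler_wpM2r// ler_expR.
  apply: le_trans (ler_norm _) _; apply: le_trans (norm_wK _ _) _.
  rewrite ler_wpM2r ?(le_trans (normr_ge0 _) (KM z))//.
  rewrite ler_norml; have := ler_norm w; have := ler_norm (- w); rewrite normrN; lra.
Qed.

End phi.

(** Provides the dominating constant for differentiating [Rpsi] under the integral without a formula
    for the derivative of [psi_slice]. *)
Lemma derive_norm_le_lipschitz (R : realType) (g : R -> R) (w C e : R) :
  derivable g w 1 -> 0 < e ->
  (forall t, `|t| < e -> `|g (t + w) - g w| <= `|t| * C) -> `|'D_1 g w| <= C.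
Proof.
move=> dg e0 gC.
have c : h^-1 *: (g (h *: 1 + w) - g w) @[h --> 0^'] --> 'D_1 g w by exact: dg.
have {}c : `|h^-1 *: (g (h *: 1 + w) - g w)| @[h --> 0^'] --> `|'D_1 g w|.
  exact: (cvg_norm c).
rewrite -(cvg_lim _ c)//; apply: limr_le; first exact: cvgP c.
exists e => //= t /=; rewrite sub0r normrN => te t0.
rewrite /GRing.scale/= mulr1 normrM normfV ler_pdivrMl ?normr_gt0//.
exact: gC.
Qed.

(** * The function psi *)

Section psi.
Context (R : realType) (d : nat) (lam : {measure set (d.-tuple R) -> \bar R}).
Hypothesis lamP : is_lebesgue_tuple lam.
Variables (K : d.-tuple R -> R) (M : R).
Hypothesis KM : forall z, `|K z| <= M.
Hypothesis intK : lam.-integrable setT (EFin \o K).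
Variable a : R.
Local Notation b := (a * d%:R).
Hypotheses (b0 : 0 < b) (b1 : b < 1).
Implicit Types (u v s t B : R).

Definition psi_slice u s : R := s `^ (- b) * phi lam K (s `^ b * (u / (1 - b))).

Local Notation C u := (`|u / (1 - b)| * expR (`|u / (1 - b)| * M)).

Lemma M_ge0 : 0 <= M.
Proof. exact: le_trans (normr_ge0 _) (KM [tuple 0 | _ < d]). Qed.

Lemma powR_itv01 s : 0 < s <= 1 -> 0 < s `^ b <= 1.
Proof.
move=> /andP[s0 s1]; rewrite powR_gt0//=.
have : s `^ b <= 1 `^ b by apply: ge0_ler_powR; rewrite ?nnegrE// ltW.
by rewrite powR1.
Qed.

(** In the variable [s ^ b] the slice is a slope of [phi] from 0. *)
Lemma psi_slice_nd u : {in `]0, 1] &, {homo psi_slice u : s t / s <= t}}.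
Proof.
move=> s t; rewrite !in_itv/= => /andP[s0 _] /andP[t0 _] st.
rewrite /psi_slice !powRN; apply: (phi_slope_nd KM intK).
  exact: powR_gt0.
by apply: ge0_ler_powR; rewrite ?nnegrE// ltW.
Qed.

(** The singular factor at 0 is cancelled by [phi w] being of order [w]. *)
Lemma psi_slice_norm u s : 0 <= s <= 1 -> `|psi_slice u s| <= C u * nK lam K.
Proof.
have nK0 := nK_ge0 lam K.
move=> /andP[s0 s1]; rewrite /psi_slice.
move: s0; rewrite le_eqVlt => /predU1P[<-|s0].
  (* At [s = 0] the power with nonzero exponent is 0 by convention, so the slice vanishes there. *)
  by rewrite powR0 ?oppr_eq0 ?gt_eqF// mul0r normr0 mulr_ge0// mulr_ge0// expR_ge0.
have /andP[sb0 sb1] : 0 < s `^ b <= 1 by apply: powR_itv01; rewrite s0.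
rewrite normrM powRN normfV (gtr0_norm sb0) ler_pdivrMl//.
apply: le_trans (phi_norm_le KM intK _) _.
rewrite normrM (gtr0_norm sb0) -!mulrA ler_pM2l// ler_wpM2l// ler_wpM2r//.
rewrite ler_expR mulrA ler_wpM2r ?M_ge0// ler_piMl//.
Qed.

Lemma measurable_psi_slice u D : measurable_fun D (psi_slice u).
Proof.
apply: measurable_funTS; apply: measurable_funM; first exact: measurable_powR.
apply: (@measurableT_comp _ _ _ _ _ _ (phi lam K)).
  apply: continuous_measurable_fun => w.
  by apply/differentiable_continuous/derivable1_diffP; exact: (phi_derivable KM intK).
by apply: measurable_funM => //; exact: measurable_powR.
Qed.

Lemma integrable_psi_slice u :
  lebesgue_measure.-integrable `]0%R, 1%R] (EFin \o psi_slice u).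
Proof.
apply: (@measurable_bounded_integrable _ _ _ lebesgue_measure) => //.
- have := @lebesgue_measure_itv R `]0, 1]; rewrite /= lte_fin ltr01 => ->.
  by rewrite -EFinB ltry.
- exact: measurable_psi_slice.
- exists (C u * nK lam K); split; first exact: num_real.
  move=> N HN s /=; rewrite in_itv/= => /andP[s0 s1].
  by rewrite (le_trans (psi_slice_norm u _)) ?(ltW s0)// ltW.
Qed.

Definition Rpsi u : R := \int[lebesgue_measure]_(s in `]0%R, 1%R]) psi_slice u s.

(** Fubini, justified by the bound [C u * |K z|], integrable over the unit interval times the whole
    space; it also shows that [psi] is finite. *)
Lemma psiE u : psi lam a K u = (Rpsi u)%:E.
Proof.
pose lamS : {sigma_finite_measure set (d.-tuple R) -> \bar R} := tuple_lebesgue lamP.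
pose D : set (R * d.-tuple R) := `[0%R, 1%R]%classic `*` [set: d.-tuple R].
pose k (p : R * d.-tuple R) := ((p.1 `^ (- b)) *
        (expR (p.1 `^ b * (u / (1 - b)) * K p.2) - 1))%:E.
pose F := k \_ D.
have mD : measurable D by exact: measurableX.
have mk : measurable_fun setT k.
  apply/measurable_EFinP; apply: measurable_funM.
    exact: (measurableT_comp (measurable_powR _)).
  apply: measurable_funB => //; apply: measurableT_comp => //.
  apply: measurable_funM.
    apply: measurable_funM => //.
    exact: (measurableT_comp (measurable_powR _)).
  have mK := measurable_smoothing_kernel intK.
  exact: (@measurableT_comp _ _ _ _ _ _ K _ snd mK).
have mF : measurable_fun setT F.
  by apply/(measurable_restrictT _ _).1 => //; exact: measurable_funTS.
have Fs s z : F (s, z) = if s \in `[0, 1]%R then k (s, z) else 0%E.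
  rewrite /F patchE /D; case: ifPn => [|/negP]; rewrite inE/= in_itv/=.
    by move=> [-> _].
  by case: ifPn => // s01 []; split.
have k_le s z : s \in `[0, 1]%R -> (`|k (s, z)| <= (C u * `|K z|)%:E)%E.
  rewrite in_itv/= => /andP[+ s1]; rewrite /k /= lee_fin.
  rewrite le_eqVlt => /predU1P[<-|s0].
    by rewrite powR0 ?oppr_eq0 ?gt_eqF// mul0r normr0 mulr_ge0// mulr_ge0// expR_ge0.
  have /andP[sb0 sb1] : 0 < s `^ b <= 1 by apply: powR_itv01; rewrite s0.
  rewrite normrM powRN normfV (gtr0_norm sb0) ler_pdivrMl//.
  apply: le_trans (norm_expK KM _ _) _.
  rewrite normrM (gtr0_norm sb0) -!mulrA ler_pM2l// ler_wpM2l// ler_wpM2r//.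
  by rewrite ler_expR mulrA ler_wpM2r ?M_ge0// ler_piMl.
have mks s : measurable_fun setT (fun z => k (s, z)).
  by apply: (measurableT_comp mk); exact: measurable_pair1.
have iks s : lam.-integrable setT
    (EFin \o (fun z => expR (s `^ b * (u / (1 - b)) * K z) - 1)).
  exact: integrable_expK KM intK _.
have kE s : (\int[lam]_z k (s, z) = (psi_slice u s)%:E)%E.
  rewrite /k /=; under eq_integral do rewrite EFinM.
  rewrite (integralZl _ (iks s))// /psi_slice EFinM /phi /Rintegral fineK//.
  exact: (integrable_fin_num _ (iks s)).
have imF : ((lebesgue_measure \x lamS)%E).-integrable setT F.
  apply/integrable12ltyP => //.
  apply: (@le_lt_trans _ _ (\int[lebesgue_measure]_(s in `[0%R, 1%R])
     (C u * nK lam K)%:E)%E).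
    rewrite [leRHS]integral_mkcond; apply: ge0_le_integral => //.
    - by move=> s _; exact: integral_ge0.
    - apply: (@measurable_fun_fubini_tonelli_F _ _ _ _ _ lamS (abse \o F)) => //=.
      exact: measurableT_comp.
    - by apply/(measurable_restrictT _ _).1.
    - move=> s _; rewrite patchE mem_setE.
      under eq_integral do rewrite Fs.
      case: ifPn => s01; last by under eq_integral do rewrite abse0; rewrite integral0.
      apply: (@le_trans _ _ (\int[lam]_z (C u * `|K z|)%:E)%E).
        apply: ge0_le_integral => //.
        - by apply: measurableT_comp => //; exact: mks.
        - apply/measurable_EFinP; apply: measurable_funM => //.
          by apply: measurableT_comp => //; exact: measurable_smoothing_kernel intK.
        - by move=> z _; exact: k_le.
      under eq_integral do rewrite EFinM.
      rewrite integralZl//; last exact: integrable_normK intK.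
      rewrite [leRHS]EFinM /nK /Rintegral fineK//.
      apply: integrable_fin_num => //; exact: integrable_normK intK.
  rewrite integral_cst//=.
  have := @lebesgue_measure_itv R `[0, 1]; rewrite /= lte_fin ltr01 => ->.
  by rewrite -EFinB -EFinM ltry.
transitivity (\int[lebesgue_measure \x lamS]_p F p)%E.
  (* [lamS] unfolds to [lam], so the two product measures agree by conversion. *)
  have -> : psi lam a K u = (\int[lebesgue_measure \x lamS]_(p in D) k p)%E by [].
  by rewrite integral_mkcond.
rewrite -integral12_prod_meas1// /fubini_F.
transitivity (\int[lebesgue_measure]_(s in `[0%R, 1%R]) (psi_slice u s)%:E)%E.
  rewrite [RHS]integral_mkcond; apply: eq_integral => s _.
  rewrite patchE mem_setE; under eq_integral do rewrite Fs.
  by case: ifPn => s01; [exact: kE|rewrite integral0].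
rewrite -(@integral_itv_obnd_cbnd R 0 (BRight 1) (EFin \o psi_slice u)); last first.
  by apply/measurable_EFinP; exact: measurable_psi_slice.
rewrite /Rpsi /Rintegral fineK//; apply: integrable_fin_num => //.
exact: integrable_psi_slice.
Qed.

Lemma Rpsi0 : Rpsi 0 = 0.
Proof.
rewrite /Rpsi /psi_slice; under eq_Rintegral do rewrite mul0r mulr0.
rewrite (_ : phi lam K 0 = 0).
  by under eq_Rintegral do rewrite mulr0; rewrite Rintegral_cst// mul0r.
rewrite /phi; under eq_Rintegral do rewrite mul0r expR0 subrr.
by rewrite Rintegral_cst// mul0r.
Qed.

Lemma Rpsi_ge u : \int[lam]_z K z = 1 -> u / (1 - b) <= Rpsi u.
Proof.
move=> K1.
have <- : \int[lebesgue_measure]_(s in `]0%R, 1%R]) (u / (1 - b)) = u / (1 - b).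
  rewrite Rintegral_cst//=; have := @lebesgue_measure_itv R `]0, 1].
  by rewrite /= lte_fin ltr01 => ->; rewrite sube0 mulr1.
apply: le_Rintegral => //.
- apply/integrableP; split; first exact: measurable_cst.
  rewrite integral_cst//=; have := @lebesgue_measure_itv R `]0, 1].
  by rewrite /= lte_fin ltr01 => ->; rewrite sube0 mule1 ltry.
- exact: integrable_psi_slice.
- move=> s; rewrite /= in_itv/= => s01.
  have /andP[sb0 sb1] := powR_itv01 s01.
  rewrite /psi_slice powRN ler_pdivlMl//.
  by have := phi_ge KM intK (s `^ b * (u / (1 - b))); rewrite K1 mulr1.
Qed.

Lemma psi_slice_lipschitz B s u u' : 0 < s <= 1 -> `|u| <= B -> `|u'| <= B ->
  `|psi_slice u s - psi_slice u' s| <=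
  `|u - u'| * ((1 - b)^-1 * expR (3 * (B / (1 - b) * M)) * nK lam K).
Proof.
move=> s01 uB uB'; have /andP[sb0 sb1] := powR_itv01 s01.
have b1' : 0 < 1 - b by rewrite subr_gt0.
have nb v : `|v| <= B -> `|s `^ b * (v / (1 - b))| <= B / (1 - b).
  move=> vB; rewrite !normrM (gtr0_norm sb0) normfV (gtr0_norm b1').
  rewrite -[leRHS]mul1r; apply: ler_pM => //; first exact: ltW.
    by rewrite divr_ge0// ltW.
  by rewrite ler_pM2r// invr_gt0.
rewrite /psi_slice -mulrBr normrM powRN normfV (gtr0_norm sb0) ler_pdivrMl//.
apply: le_trans (phi_lipschitz KM intK (nb _ uB) (nb _ uB')) _.
rewrite -mulrBr -mulrBl !normrM (gtr0_norm sb0) normfV (gtr0_norm b1').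
by rewrite le_eqVlt; apply/orP; left; apply/eqP; ring.
Qed.

Lemma psi_slice_derivable s (u : R) : derivable (psi_slice ^~ s) u 1.
Proof.
apply: derivableM => //; apply/derivable1_diffP.
apply: (@differentiable_comp _ _ _ _ (fun w : R => s `^ b * (w / (1 - b))) (phi lam K)).
  by apply/derivable1_diffP; exact: ex_derive.
by apply/derivable1_diffP; exact: (phi_derivable KM intK).
Qed.

Lemma Rpsi_derivable (u : R) : derivable Rpsi u 1.
Proof.
(* The 2 is one unit for the interval around [u] and one for the increments used to bound the
   derivative. *)
pose Cu := (1 - b)^-1 * expR (3 * ((`|u| + 2) / (1 - b) * M)) * nK lam K.
have b1' : 0 < 1 - b by rewrite subr_gt0.
apply: (@derivable_under_integral _ _ _ lebesgue_measure psi_slice `]0%R, 1%R]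
  _ u (u - 1) (u + 1) _ _ _ (fun=> Cu)) => //.
- by rewrite /= in_itv/=; lra.
- by move=> v _; exact: integrable_psi_slice.
- by move=> v s _ _; exact: psi_slice_derivable.
- by move=> s; rewrite /Cu mulr_ge0 ?nK_ge0// mulr_ge0 ?expR_ge0// invr_ge0 ltW.
- apply/integrableP; split; first exact: measurable_cst.
  rewrite integral_cst//=; have := @lebesgue_measure_itv R `]0, 1].
  by rewrite /= lte_fin ltr01 => ->; rewrite sube0 mule1 ltry.
- move=> v s; rewrite /= !in_itv/= => /andP[v1 v2] s01.
  rewrite partial1of2E; apply: (@derive_norm_le_lipschitz _ _ _ _ 1) => //.
    exact: psi_slice_derivable.
  have vu : `|v| <= `|u| + 1.
    by rewrite ler_norml; have := ler_norm u; have := ler_norm (- u); rewrite normrN; lra.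
  move=> t t1; rewrite -[X in `|X| * _](addrK v); apply: psi_slice_lipschitz => //.
    by apply: le_trans (ler_normD _ _) _; lra.
  lra.
Qed.

End psi.

(** * Riemann sums of monotone functions on the half-open unit interval *)

Section riemann_sum.
Context (R : realType).
Implicit Types (g : R -> R) (p q l m c : R).

Lemma Rintegral_itv_bounds g p q l m : p < q ->
  lebesgue_measure.-integrable `]p, q] (EFin \o g) ->
  (forall s, p < s <= q -> l <= g s <= m) ->
  l * (q - p) <= \int[lebesgue_measure]_(s in `]p, q]) g s <= m * (q - p).
Proof.
move=> pq ig glm.
have cE (k : R) : \int[lebesgue_measure]_(s in `]p, q]) k = k * (q - p).
  rewrite Rintegral_cst//=; have := @lebesgue_measure_itv R `]p, q].
  by rewrite /= lte_fin pq => ->.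
have ci (k : R) : lebesgue_measure.-integrable `]p, q] (EFin \o cst k).
  apply/integrableP; split; first exact/measurable_EFinP/measurable_cst.
  rewrite [X in (X < _)%E](_ : _ =
    \int[lebesgue_measure]_(x in `]p, q]) cst `|k|%:E x)%E//.
  rewrite integral_cst//=; have := @lebesgue_measure_itv R `]p, q].
  by rewrite /= lte_fin pq => ->; rewrite -EFinB -EFinM ltry.
by rewrite -!cE; apply/andP; split; apply: le_Rintegral => //; try exact: ci;
  move=> s; rewrite /= in_itv/= => /glm /andP[].
Qed.

Lemma riemann_sum_nd g c :
  (forall s t : R, 0 < s -> s <= t -> t <= 1 -> g s <= g t) ->
  (forall s : R, 0 < s <= 1 -> - c <= g s) ->
  lebesgue_measure.-integrable `]0, 1] (EFin \o g) ->
  n.+1%:R^-1 * \sum_(i < n.+1) g (i.+1%:R / n.+1%:R) @[n --> \oo] -->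
    \int[lebesgue_measure]_(s in `]0, 1]) g s.
Proof.
move=> gnd gc ig.
have igS p q : 0 <= p -> q <= 1 -> lebesgue_measure.-integrable `]p, q] (EFin \o g).
  move=> p0 q1; apply: integrableS ig => //.
  by move=> s; rewrite /= !in_itv/= => /andP[? ?]; apply/andP; split; lra.
(* Upper and lower sums up to cell [k]. The function is not controlled at 0, so [- c] stands for its
   left value on the first cell; at [k = n] the two sums differ by [(c + g 1) / n.+1]. *)
have bounds n k : (k <= n)%N ->
  n.+1%:R^-1 * (\sum_(i < k) g (i.+1%:R / n.+1%:R) - c) <=
    \int[lebesgue_measure]_(s in `]0, k.+1%:R / n.+1%:R]) g s <=
  n.+1%:R^-1 * \sum_(i < k.+1) g (i.+1%:R / n.+1%:R).
  set N : R := n.+1%:R; have N0 : 0 < N by rewrite ltr0n.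
  elim: k => [_|k IH kn].
    rewrite big_ord0 big_ord1 sub0r mul1r.
    have N1 : N^-1 <= 1 by rewrite invf_le1// ler1n.
    have := @Rintegral_itv_bounds g 0 N^-1 (- c) (g N^-1).
    rewrite subr0 ![_ * N^-1]mulrC; apply; first by rewrite invr_gt0.
      by apply: igS.
    move=> s /andP[s0 sN]; rewrite gnd// andbT gc// s0/=.
    exact: le_trans sN N1.
  have /andP[IH1 IH2] := IH (ltnW kn).
  have q1 : k.+2%:R / N <= 1 by rewrite ler_pdivrMr// mul1r ler_nat.
  have p0 : 0 < k.+1%:R / N by rewrite divr_gt0// ltr0n.
  have pqE : k.+2%:R / N - k.+1%:R / N = N^-1.
    by rewrite -mulrBl -natrB// subSnn mul1r.
  have pq : k.+1%:R / N < k.+2%:R / N.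
    by rewrite -subr_gt0 pqE invr_gt0.
  have /andP[b1 b2] : g (k.+1%:R / N) * N^-1 <=
      \int[lebesgue_measure]_(s in `]k.+1%:R / N, k.+2%:R / N]) g s <=
      g (k.+2%:R / N) * N^-1.
    have := @Rintegral_itv_bounds g (k.+1%:R / N) (k.+2%:R / N)
      (g (k.+1%:R / N)) (g (k.+2%:R / N)) pq; rewrite pqE; apply.
      by apply: igS => //; exact: ltW.
    move=> s /andP[s0 sN]; rewrite !gnd//; first exact: lt_trans s0.
    + exact: ltW.
    + exact: le_trans q1.
  have E : \int[lebesgue_measure]_(s in `]0, k.+2%:R / N]) g s =
     \int[lebesgue_measure]_(s in `]0, k.+1%:R / N]) g s +
     \int[lebesgue_measure]_(s in `]k.+1%:R / N, k.+2%:R / N]) g s.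
    rewrite -(@Rintegral_itvB _ g (BRight 0) (BRight (k.+2%:R / N)) (k.+1%:R / N)).
    - by rewrite addrC subrK.
    - by apply: igS.
    - by rewrite bnd_simp ltW.
    - by rewrite bnd_simp ltW.
  rewrite E; apply/andP; split; rewrite big_ord_recr/= ?[_ + _ - c]addrAC mulrDr.
    by apply: lerD => //; rewrite mulrC.
  by apply: lerD => //; rewrite [leRHS]mulrC.
set I := \int[lebesgue_measure]_(s in _) _.
have {}bounds n : I <= n.+1%:R^-1 * \sum_(i < n.+1) g (i.+1%:R / n.+1%:R) <=
    I + (c + g 1) * n.+1%:R^-1.
  have := bounds n n (leqnn n); rewrite divff// -/I => /andP[h1 h2].
  rewrite h2/= big_ord_recr/= divff//; move: h1; set S := \sum_(i < n) _.
  by move: (n.+1%:R^-1) S => e S; lra.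
apply: (@squeeze_cvgr _ _ _ _ (cst I) (fun n => I + (c + g 1) * n.+1%:R^-1)).
- by apply: nearW.
- exact: cvg_cst.
- rewrite -[X in _ --> X]addr0; apply: cvgD; first exact: cvg_cst.
  rewrite -[X in _ --> X](mulr0 (c + g 1)); apply: cvgM; first exact: cvg_cst.
  exact: cvg_harmonic.
Qed.

End riemann_sum.

(** * Power sums and weighted means *)

Section power_sums.
Context (R : realType).
Implicit Types (x y p r : R).

(** Concavity of the power, read off from the slopes of the exponential at [p <= 1] in the direction
    [ln y - ln x]. *)
Lemma powR_tangent x y p : 0 < x -> 0 <= y -> 0 < p <= 1 ->
  y `^ p <= x `^ p + p * x `^ (p - 1) * (y - x).
Proof.
move=> x0 y0 /andP[p0 p1].
have x_n0 : x != 0 by rewrite gt_eqF.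
have E r : x `^ r = expR (r * ln x) by rewrite /powR (negbTE x_n0).
have xE : x = expR (ln x) by rewrite lnK// posrE.
have xp : x `^ (p - 1) * x = x `^ p.
  by rewrite !E [X in _ * X = _]xE -expRD; congr expR; lra.
move: y0; rewrite le_eqVlt => /predU1P[<-|y0].
  rewrite powR0 ?gt_eqF// sub0r mulrN -mulrA xp.
  have := powR_ge0 x p; nra.
have yE : y = expR (ln y) by rewrite lnK// posrE.
have -> : y `^ p = x `^ p * expR (p * (ln y - ln x)).
  by rewrite E -expRD /powR gt_eqF//; congr expR; lra.
have := expR_slope_nd (ln y - ln x) p0 p1.
rewrite invr1 !mul1r ler_pdivrMl// => h.
have h2 : x `^ (p - 1) * y = x `^ p * expR (ln y - ln x).
  by rewrite !E [X in _ * X = _]yE -!expRD; congr expR; lra.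
have -> : p * x `^ (p - 1) * (y - x) = p * (x `^ p * expR (ln y - ln x) - x `^ p).
  by rewrite -h2 -[in X in _ = _ * (_ - X)]xp; ring.
have := ler_wpM2l (powR_ge0 x p) h; lra.
Qed.

Lemma powR_natr_cvgy p : 0 < p -> (n.+1%:R : R) `^ p @[n --> \oo] --> +oo.
Proof.
move=> p0; apply/cvgryPge => A.
have [A0|A0] := leP A 0; first by apply: nearW => n; exact: le_trans (powR_ge0 _ _).
have /cvgryPge/(_ (A `^ p^-1)) : (n.+1%:R : R) @[n --> \oo] --> +oo.
  by rewrite (cvg_shiftS (fun n => n%:R : R)); exact: cvgr_idn.
apply: filterS => n nA.
have -> : A = (A `^ p^-1) `^ p by rewrite -powRrM mulVf ?gt_eqF// powRr1// ltW.
by apply: ge0_ler_powR => //; rewrite ?nnegrE ?powR_ge0// ltW.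
Qed.

Variable b : R.
Hypotheses (b0 : 0 < b) (b1 : b < 1).

Definition psum n : R := \sum_(i < n) i.+1%:R `^ (- b).

Let p0 : 0 < 1 - b. Proof. by rewrite subr_gt0. Qed.
Let p01 : 0 < 1 - b <= 1. Proof. by rewrite p0 lerBlDr lerDl ltW. Qed.

(** The tangent at [n.+1] evaluated at [n] bounds each term by a telescoping difference; evaluated
    at [n.+2] it gives the reverse bound [psum_ge]. *)
Lemma psum_le n : (1 - b) * psum n <= n%:R `^ (1 - b).
Proof.
elim: n => [|n IH]; first by rewrite /psum big_ord0 mulr0 powR_ge0.
have := @powR_tangent n.+1%:R n%:R (1 - b) (ltr0Sn _ _) (ler0n _ _) p01.
rewrite /psum big_ord_recr/= -/(psum n) (_ : 1 - b - 1 = - b); last by ring.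
rewrite (_ : n%:R - n.+1%:R = -1 :> R); last by rewrite -natr1; ring.
by move: IH; lra.
Qed.

Lemma psum_ge n : n.+1%:R `^ (1 - b) - 1 <= (1 - b) * psum n.
Proof.
elim: n => [|n IH]; first by rewrite /psum big_ord0 mulr0 powR1 subrr.
have := @powR_tangent n.+1%:R n.+2%:R (1 - b) (ltr0Sn _ _) (ler0n _ _) p01.
rewrite /psum big_ord_recr/= -/(psum n) (_ : 1 - b - 1 = - b); last by ring.
rewrite (_ : n.+2%:R - n.+1%:R = 1 :> R); last by rewrite -(natr1 n.+1); ring.
by move: IH; lra.
Qed.

Lemma psum_gt0 n : 0 < psum n.+1.
Proof.
rewrite /psum big_ord_recr/=; apply: ltr_wpDl; last exact: powR_gt0.
by apply: sumr_ge0 => i _; exact: powR_ge0.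
Qed.

Lemma psum_cvgy : psum n.+1 @[n --> \oo] --> +oo.
Proof.
apply/cvgryPge => A.
have /cvgryPge/(_ ((1 - b) * A + 1)) := powR_natr_cvgy p0.
apply: filterS => n nA.
rewrite -(ler_pM2l p0); apply: le_trans (psum_ge _).
have : n.+1%:R `^ (1 - b) <= n.+2%:R `^ (1 - b).
  by apply: ge0_ler_powR => //; rewrite ?nnegrE ?(ltW p0)// ler_nat.
lra.
Qed.

Definition rho n : R := psum n.+1 / n.+1%:R `^ (1 - b).

Lemma rho_gt0 n : 0 < rho n.
Proof. by rewrite divr_gt0 ?psum_gt0// powR_gt0. Qed.

Lemma rho_le n : (1 - b) * rho n <= 1.
Proof. by rewrite mulrA ler_pdivrMr ?powR_gt0// mul1r psum_le. Qed.

Lemma rho_cvg : (1 - b) * rho n @[n --> \oo] --> (1 : R).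
Proof.
apply: (@squeeze_cvgr _ _ _ _ (fun n => 1 - (n.+1%:R `^ (1 - b))^-1) (cst 1)).
- apply: nearW => n /=; rewrite rho_le andbT mulrA ler_pdivlMr ?powR_gt0//.
  rewrite mulrBl mul1r mulVf ?gt_eqF ?powR_gt0//.
  apply: le_trans (psum_ge _).
  have : n.+1%:R `^ (1 - b) <= n.+2%:R `^ (1 - b).
    by apply: ge0_ler_powR => //; rewrite ?nnegrE ?(ltW p0)// ler_nat.
  lra.
- rewrite -[X in _ --> X]subr0; apply: cvgB; first exact: cvg_cst.
  by apply/gtr0_cvgV0; [apply: nearW => n; exact: powR_gt0|exact: powR_natr_cvgy].
- exact: cvg_cst.
Qed.

End power_sums.

Section weighted_cesaro.
Context (R : realType).
Variables (w eta : nat -> R).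
Hypothesis w_gt0 : forall i, 0 < w i.
Hypothesis w_cvgy : \sum_(i < n.+1) w i @[n --> \oo] --> +oo.
Hypothesis eta0 : eta n @[n --> \oo] --> (0 : R).

Lemma weighted_cesaro :
  (\sum_(i < n.+1) w i)^-1 * \sum_(i < n.+1) w i * eta i @[n --> \oo] --> (0 : R).
Proof.
apply/cvgrPdist_le => e e0.
have e2 : 0 < e / 2 by rewrite divr_gt0.
move/cvgrPdist_le : eta0 => /(_ _ e2)[m _ mP].
(* The head is a fixed number, eventually small against the diverging total weight; in the tail
   every [eta i] is at most [e / 2]. *)
pose C := \sum_(i < m) w i * `|eta i|.
have /cvgryPge/(_ (C / (e / 2))) := w_cvgy.
move=> Cn; near=> n.
have W0 : 0 < \sum_(i < n.+1) w i.
  rewrite big_ord_recr/=; apply: ltr_wpDl => //.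
  by apply: sumr_ge0 => i _; exact: ltW.
have WC : C <= (\sum_(i < n.+1) w i) * (e / 2).
  by rewrite -ler_pdivrMr//; near: n.
have mn : (m <= n.+1)%N by near: n; exists m => // k /= /leqW.
rewrite sub0r normrN normrM normfV (gtr0_norm W0) ler_pdivrMl//.
apply: le_trans (ler_norm_sum _ _ _) _.
under eq_bigr do rewrite normrM (gtr0_norm (w_gt0 _)).
rewrite -(subnKC mn) big_split_ord/= -/C subnKC//.
have -> : (\sum_(i < n.+1) w i) * e =
   (\sum_(i < n.+1) w i) * (e / 2) + (\sum_(i < n.+1) w i) * (e / 2) by lra.
apply: lerD => //.
apply: (@le_trans _ _ ((\sum_(i < n.+1 - m) w (m + i)%N) * (e / 2))).
  rewrite mulr_suml; apply: ler_sum => i _; rewrite ler_pM2l//.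
  have := mP (m + i)%N; rewrite /= sub0r normrN; apply; exact: leq_addr.
rewrite ler_pM2r// -[in leRHS](subnKC mn) big_split_ord/= lerDr.
by apply: sumr_ge0 => i _; exact: ltW.
Unshelve. all: by end_near. Qed.

End weighted_cesaro.

(** * Laplace transform of one observation *)

Section smoothed_density.
Context (R : realType) (d : nat) (lam : {measure set (d.-tuple R) -> \bar R}).
Hypothesis lamP : is_lebesgue_tuple lam.
Variables (K f : d.-tuple R -> R) (M Mf : R) (x : d.-tuple R).
Hypothesis KM : forall z, `|K z| <= M.
Hypothesis intK : lam.-integrable setT (EFin \o K).
Hypothesis mf : measurable_fun setT f.
Hypothesis f0 : forall z, 0 <= f z.
Hypothesis fM : forall z, f z <= Mf.
Implicit Types (w h r : R) (z : d.-tuple R).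

Definition fshift h z := f (affine x h z).

Definition smoothed_phi h w : R := \int[lam]_z ((expR (w * K z) - 1) * fshift h z).

Definition kernel_bias h : R := \int[lam]_z (`|K z| * `|fshift h z - f x|).

Lemma measurable_fshift h : measurable_fun setT (fshift h).
Proof. exact: (measurableT_comp mf (measurable_affine x h)). Qed.

Lemma Mf_ge0 : 0 <= Mf.
Proof. exact: le_trans (f0 x) (fM x). Qed.

Lemma measurable_expK_fshift h w :
  measurable_fun setT (fun z => (expR (w * K z) - 1) * fshift h z).
Proof.
apply: measurable_funM; last exact: measurable_fshift.
by apply: measurable_funB => //; exact: (measurable_expK intK).
Qed.

Lemma norm_expK_fshift h w z : `|(expR (w * K z) - 1) * fshift h z| <=
  `|w| * expR (`|w| * M) * Mf * `|K z|.
Proof.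
rewrite normrM mulrAC; apply: ler_pM => //; first exact: norm_expK.
by rewrite ger0_norm ?f0// fM.
Qed.

Lemma smoothed_phi_norm h w :
  `|smoothed_phi h w| <= `|w| * expR (`|w| * M) * Mf * nK lam K.
Proof.
apply: (norm_Rintegral_leK intK) => [|z]; last exact: norm_expK_fshift.
exact: measurable_expK_fshift.
Qed.

Lemma norm_fshift_sub h z : `|fshift h z - f x| <= Mf.
Proof.
rewrite ler_norml /fshift; have := f0 (affine x h z); have := fM (affine x h z).
by have := f0 x; have := fM x; lra.
Qed.

Lemma measurable_bias h : measurable_fun setT (fun z => `|K z| * `|fshift h z - f x|).
Proof.
apply: measurable_funM.
  by apply: measurableT_comp => //; exact: (measurable_smoothing_kernel intK).
apply: measurableT_comp => //; apply: measurable_funB => //.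
exact: measurable_fshift.
Qed.

Lemma integrable_bias h :
  lam.-integrable setT (EFin \o (fun z => `|K z| * `|fshift h z - f x|)).
Proof.
apply: (integrable_leK (C := Mf) intK); first exact: measurable_bias.
by move=> z; rewrite normrM !normr_id mulrC ler_wpM2r// norm_fshift_sub.
Qed.

(** The dependence on [w] is split off, so [kernel_bias] sees the bandwidth alone and one limit
    along [h] serves every row of the array. *)
Lemma smoothed_phi_bias h w : `|smoothed_phi h w - f x * phi lam K w| <=
  `|w| * expR (`|w| * M) * kernel_bias h.
Proof.
have i1 : lam.-integrable setT (EFin \o (fun z => (expR (w * K z) - 1) * fshift h z)).
  apply: (integrable_leK intK (measurable_expK_fshift h w)) => z.
  exact: norm_expK_fshift.
have i2 := integrable_expK KM intK w.
have i2' : lam.-integrable setT (EFin \o (fun z => f x * (expR (w * K z) - 1))).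
  exact: (integrableZl _ _ i2).
have i3 := integrableB measurableT i1 i2'.
rewrite /smoothed_phi /phi -RintegralZl// -RintegralB//.
apply: le_trans (le_normr_Rintegral _ _) _ => //.
rewrite /kernel_bias -RintegralZl//; last exact: integrable_bias.
apply: le_Rintegral => //.
- exact: integrable_abse i3.
- exact: (integrableZl _ _ (integrable_bias h)).
- move=> z _; rewrite [f x * _]mulrC -mulrBr normrM mulrA ler_wpM2r//.
  exact: norm_expK.
Qed.

Hypothesis fcont : continuous_at_tuple f x.

Lemma fshift_cvg (h : nat -> R) z : h n @[n --> \oo] --> (0 : R) ->
  fshift (h n) z @[n --> \oo] --> f x.
Proof.
move=> h0; apply/cvgrPdist_lt => e e0.
have [del del0 H] := fcont e0.
have s0 : 0 < supnorm z + 1.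
  apply: ltr_wpDl => //; exact: bigmax_ge_id.
(* The added 1 avoids dividing by zero when [z] is the origin. *)
have /cvgrPdist_lt/(_ (del / (supnorm z + 1))) := h0.
rewrite divr_gt0// => /(_ isT); apply: filterS => n.
rewrite sub0r normrN ltr_pdivlMr// => hn.
rewrite distrC; apply: H; apply: bigmax_lt => // i _.
rewrite /affine !tnth_mktuple.
have -> : tnth x i - h n * tnth z i - tnth x i = - (h n * tnth z i) by ring.
rewrite normrN normrM; apply: le_lt_trans hn; rewrite ler_wpM2l//.
by apply: le_trans (normr_tnth_supnorm z i) _; rewrite lerDl.
Qed.

Lemma kernel_bias_cvg0 (h : nat -> R) : h n @[n --> \oo] --> (0 : R) ->
  kernel_bias (h n) @[n --> \oo] --> (0 : R).
Proof.
move=> h0; apply: fine_cvg.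
rewrite [X in _ --> X](_ : _ = \int[lam]_z 0)%E; last by rewrite integral0.
apply: (@dominated_cvg _ _ _ lam setT measurableT
  (fun n z => (`|K z| * `|fshift (h n) z - f x|)%:E) _ (fun z => (Mf * `|K z|)%:E)) => //.
- by move=> n; apply/measurable_EFinP; exact: measurable_bias.
- move=> z _; apply: cvg_EFin; first exact: nearW.
  rewrite /comp/= -[X in _ --> X](mulr0 `|K z|); apply: cvgM; first exact: cvg_cst.
  apply/norm_cvg0P; rewrite -[X in _ --> X](subrr (f x)).
  by apply: cvgB; [exact: fshift_cvg|exact: cvg_cst].
- exact: (integrableZl _ _ (integrable_normK intK)).
- move=> n z _ /=; rewrite lee_fin normrM !normr_id mulrC ler_wpM2r//.
  exact: norm_fshift_sub.
Qed.

Context (d0 : measure_display) (Omega : measurableType d0) (P : probability Omega R).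
Variable Y : Omega -> d.-tuple R.
Hypothesis mY : measurable_fun setT Y.
Hypothesis Yf : has_density P lam Y f.

Lemma measurable_rescale r :
  measurable_fun setT (fun y : d.-tuple R => vscale r^-1 (vsub x y)).
Proof.
apply/measurable_fun_tnthP => i.
rewrite (_ : _ \o _ = (fun z => r^-1 * (tnth x i - tnth z i))).
  apply: measurable_funM => //; apply: measurable_funB => //.
  exact: measurable_tnth.
by apply/funext => z /=; rewrite !tnth_mktuple.
Qed.

Lemma measurable_exp_kernel r w :
  measurable_fun setT (fun o => expR (w * K (vscale r^-1 (vsub x (Y o))))).
Proof.
have m1 := measurableT_comp (measurable_rescale r) mY.
exact: (measurableT_comp (measurable_expK intK w) m1).
Qed.

Lemma ge0_expectation_density (g : d.-tuple R -> \bar R) :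
  measurable_fun setT g -> (forall y, 0 <= g y)%E ->
  (\int[P]_o g (Y o) = \int[lam]_y (g y * (f y)%:E))%E.
Proof.
move=> mg g0.
rewrite -(@ge0_integral_density _ _ _ _ _ (image_measure P mY) lam id f)//.
by rewrite ge0_integral_pushforward// preimage_setT.
Qed.

Lemma ge0_expectation_scaled r (g : d.-tuple R -> R) : 0 < r ->
  measurable_fun setT g -> (forall y, 0 <= g y) ->
  (\int[P]_o (g (vscale r^-1 (vsub x (Y o))))%:E =
   (r ^+ d)%:E * \int[lam]_z (g z * fshift r z)%:E)%E.
Proof.
move=> r0 mg g0.
pose S (y : d.-tuple R) := vscale r^-1 (vsub x y).
have mS : measurable_fun setT S by exact: measurable_rescale.
have mgS : measurable_fun setT (g \o S) by exact: (measurableT_comp mg mS).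
rewrite (@ge0_expectation_density (EFin \o (g \o S))); last 2 first.
- exact/measurable_EFinP.
- by move=> y /=; rewrite lee_fin; exact: g0.
rewrite (ge0_integral_affine lamP x r0); last 2 first.
- by apply: emeasurable_funM; apply/measurable_EFinP.
- by move=> y; rewrite mule_ge0//= lee_fin; [exact: g0|exact: f0].
congr (_ * _)%E; apply: eq_integral => z _ /=.
by rewrite /S (@affineK R d x r _ z)// gt_eqF.
Qed.

(** Total mass 1 of the law, rescaled. It makes the shifted density integrable, so that the constant
    1 can be separated from the exponential. *)
Lemma integral_fshift r : 0 < r ->
  (\int[lam]_z (fshift r z)%:E = ((r ^+ d)^-1)%:E)%E.
Proof.
move=> r0; have rd0 : 0 < r ^+ d by rewrite exprn_gt0.
have := @ge0_expectation_scaled r (cst 1) r0 (measurable_cst _) (fun=> ler01).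
have P1 : (\int[P]_o (1 : R)%:E = 1)%E by rewrite integral_cst//= probability_setT mule1.
rewrite /= P1 => /esym.
under eq_integral do rewrite mul1r.
move=> H; rewrite -[LHS]mul1e -(mulVf (lt0r_neq0 rd0)) EFinM -muleA.
by rewrite [X in (_ * X)%E]H mule1.
Qed.

Lemma expectation_exp_kernel r w : 0 < r ->
  (\int[P]_o (expR (w * K (vscale r^-1 (vsub x (Y o)))))%:E =
   (1 + r ^+ d * smoothed_phi r w)%:E)%E.
Proof.
move=> r0; have rd0 : 0 < r ^+ d by rewrite exprn_gt0.
rewrite (@ge0_expectation_scaled r (fun z => expR (w * K z)) r0); last 2 first.
- exact: (measurable_expK intK).
- by move=> z; exact: expR_ge0.
have ifs : lam.-integrable setT (EFin \o fshift r).
  apply/integrableP; split; first by apply/measurable_EFinP; exact: measurable_fshift.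
  under eq_integral do rewrite /= ger0_norm ?f0//.
  by rewrite integral_fshift// ltry.
have i1 : lam.-integrable setT (EFin \o (fun z => (expR (w * K z) - 1) * fshift r z)).
  apply: (integrable_leK intK (measurable_expK_fshift r w)) => z.
  exact: norm_expK_fshift.
have -> : (\int[lam]_z (expR (w * K z) * fshift r z)%:E)%E =
    (\int[lam]_z ((fshift r z)%:E + ((expR (w * K z) - 1) * fshift r z)%:E))%E.
  by apply: eq_integral => z _; rewrite -EFinD; congr (_%:E); ring.
rewrite integralD// integral_fshift// /smoothed_phi.
rewrite -[X in (_ + X)%E]fineK; last exact: (integrable_fin_num _ i1).
by rewrite -EFinD -EFinM mulrDr divff// gt_eqF.
Qed.

(** Keeps the argument of the logarithm away from 0, uniformly in the bandwidth. *)
Lemma expectation_exp_kernel_ge r w : 0 < r ->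
  expR (- (`|w| * M)) <= 1 + r ^+ d * smoothed_phi r w.
Proof.
move=> r0; rewrite -lee_fin -expectation_exp_kernel//.
have <- : (\int[P]_o (expR (- (`|w| * M)))%:E = (expR (- (`|w| * M)))%:E)%E.
  by rewrite integral_cst//= probability_setT mule1.
apply: ge0_le_integral => //.
- by apply/measurable_EFinP; exact: measurable_exp_kernel.
- move=> o _; rewrite lee_fin ler_expR.
  by have := norm_wK KM w (vscale r^-1 (vsub x (Y o))); rewrite ler_norml => /andP[].
Qed.

End smoothed_density.

(** * The recursive estimator *)

Section recursive_estimator.
Context (R : realType) (d : nat) (lam : {measure set (d.-tuple R) -> \bar R})
  (d0 : measure_display) (Omega : measurableType d0) (P : probability Omega R).
Variables (X : nat -> Omega -> d.-tuple R) (f K : d.-tuple R -> R)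
  (c a : R) (h : nat -> R) (x : d.-tuple R) (M Mf : R).
Hypothesis lamP : is_lebesgue_tuple lam.
Hypothesis mX : forall i, measurable_fun setT (X i).
Hypothesis indX : mutually_independent P X.
Hypothesis mf : measurable_fun setT f.
Hypothesis f0 : forall z, 0 <= f z.
Hypothesis fM : forall z, f z <= Mf.
Hypothesis Xf : forall i, has_density P lam (X i) f.
Hypothesis KM : forall z, `|K z| <= M.
Hypothesis intK : lam.-integrable setT (EFin \o K).
Hypothesis K1 : \int[lam]_z K z = 1.
Hypotheses (c0 : 0 < c) (a0 : 0 < a).
Local Notation b := (a * d%:R).
Hypotheses (b0 : 0 < b) (b1 : b < 1).
Hypothesis hE : forall n, (0 < n)%N -> h n = c * n%:R `^ (- a).
Hypothesis fcont : continuous_at_tuple f x.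
Implicit Types (u : R) (n i : nat).

(** Index [n] stands for sample size [n.+1], in step with [rke K h X n.+1]. *)
Definition speed n : R := \sum_(1 <= i < n.+2) h i ^+ d.

Let p0 : 0 < 1 - b. Proof. by rewrite subr_gt0. Qed.

Lemma h_gt0 i : 0 < h i.+1.
Proof. by rewrite hE// mulr_gt0// powR_gt0. Qed.

Lemma hd_gt0 i : 0 < h i.+1 ^+ d.
Proof. by rewrite exprn_gt0// h_gt0. Qed.

Lemma hdE i : h i.+1 ^+ d = c ^+ d * i.+1%:R `^ (- b).
Proof.
rewrite hE// exprMn; congr (_ * _).
by rewrite -powR_mulrn ?powR_ge0// -powRrM mulNr.
Qed.

Lemma h_cvg0 : h n.+1 @[n --> \oo] --> (0 : R).
Proof.
rewrite (_ : (fun n => _) = (fun n => c * (n.+1%:R `^ a)^-1)); last first.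
  by apply/funext => n; rewrite hE// powRN.
rewrite -[X in _ --> X](mulr0 c); apply: cvgM; first exact: cvg_cst.
by apply/gtr0_cvgV0; [apply: nearW => n; exact: powR_gt0|exact: powR_natr_cvgy].
Qed.

Lemma speedE n : speed n = \sum_(i < n.+1) h i.+1 ^+ d.
Proof. by rewrite /speed big_add1/= big_mkord. Qed.

Lemma speed_psum n : speed n = c ^+ d * psum b n.+1.
Proof.
by rewrite speedE /psum mulr_sumr; apply: eq_bigr => i _; rewrite hdE.
Qed.

Lemma speed_gt0 n : 0 < speed n.
Proof. by rewrite speed_psum mulr_gt0 ?exprn_gt0// psum_gt0. Qed.

Lemma speed_nd : nondecreasing_seq speed.
Proof.
apply/nondecreasing_seqP => n; rewrite !speedE [leRHS]big_ord_recr/= lerDl.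
exact/ltW/hd_gt0.
Qed.

Lemma speed_cvgy : speed @ \oo --> +oo.
Proof.
apply/cvgryPge => A; have cd0 : 0 < c ^+ d by rewrite exprn_gt0.
have /cvgryPge/(_ (A / c ^+ d)) := psum_cvgy b0 b1.
by apply: filterS => n; rewrite ler_pdivrMr// mulrC -speed_psum.
Qed.

Definition tilt n i : R := speed n / (n.+1%:R * h i.+1 ^+ d).

Lemma powR_div (s t r : R) : 0 <= s -> 0 < t -> (s / t) `^ r = s `^ r / t `^ r.
Proof.
move=> s0 t0; have tr : t `^ r != 0 by rewrite gt_eqF// powR_gt0.
apply: (mulIf tr); rewrite divfK// -powRM ?divfK ?gt_eqF//; last exact: ltW.
by rewrite divr_ge0// ltW.
Qed.

(** The bandwidth constant [c ^+ d] cancels and so leaves no trace in the limit. *)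
Lemma tiltE n i : tilt n i = rho b n * (i.+1%:R / n.+1%:R) `^ b.
Proof.
rewrite /tilt speed_psum hdE powR_div// /rho powRN.
have N0 : (0 : R) < n.+1%:R by [].
have NE : n.+1%:R `^ (1 - b) * n.+1%:R `^ b = n.+1%:R :> R.
  by rewrite -powRD ?subrK ?powRr1// (gt_eqF N0) implybT.
rewrite -[X in _ / (X * _) = _]NE; field.
have n1 (k : nat) (r : R) : k.+1%:R `^ r != 0 by rewrite gt_eqF// powR_gt0.
by rewrite !n1 expf_neq0// gt_eqF.
Qed.

Lemma tilt_ge0 n i : 0 <= tilt n i.
Proof. by rewrite divr_ge0 ?mulr_ge0// ltW// ?speed_gt0// hd_gt0. Qed.

Lemma tilt_le n i : (i < n.+1)%N -> tilt n i <= (1 - b)^-1.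
Proof.
move=> lin; rewrite tiltE -[leRHS]mulr1; apply: ler_pM.
- exact/ltW/rho_gt0.
- exact: powR_ge0.
- by rewrite -[leRHS]mulr1 ler_pdivlMl// rho_le.
- suff /andP[] : 0 < (i.+1%:R / n.+1%:R) `^ b <= 1 by [].
  apply: powR_itv01 => //.
  by rewrite divr_gt0//= ler_pdivrMr// mul1r ler_nat.
Qed.

Local Notation sphi := (smoothed_phi lam K f x).

Definition log_mgf n u : R := - (u * f x) +
  (speed n)^-1 * \sum_(i < n.+1) ln (1 + h i.+1 ^+ d * sphi (h i.+1) (u * tilt n i)).

(** All observations share the density [f], so observation 0 can be used for every bandwidth. *)
Lemma one_sphi_gt0 i w : 0 < 1 + h i.+1 ^+ d * sphi (h i.+1) w.
Proof.
apply: lt_le_trans (expR_gt0 (- (`|w| * M))) _.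
by apply: (expectation_exp_kernel_ge lamP x KM intK mf f0 fM (mX 0) (Xf 0)); exact: h_gt0.
Qed.

Lemma measurable_rke n : measurable_fun setT (fun o => rke K h X n.+1 x o - f x).
Proof.
apply: measurable_funB => //; apply: measurable_funM => //.
apply: measurable_sum => i; apply: measurable_funM => //.
have mS := measurable_rescale x (h i.+1).
have mK := measurable_smoothing_kernel intK.
exact: (measurableT_comp (measurableT_comp mK mS) (mX i)).
Qed.

Lemma mgf_rke n u :
  (\int[P]_o (expR (speed n * (u * (rke K h X n.+1 x o - f x))))%:E =
   (expR (speed n * log_mgf n u))%:E)%E.
Proof.
pose g i (y : d.-tuple R) :=
  expR (u * tilt n i * K (vscale (h i.+1)^-1 (vsub x y))).
have gE i : (\int[P]_o (g i (X i o))%:E =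
    (1 + h i.+1 ^+ d * sphi (h i.+1) (u * tilt n i))%:E)%E.
  exact: (expectation_exp_kernel lamP x KM intK mf f0 fM (mX i) (Xf i) _ (h_gt0 i)).
have mg i : measurable_fun setT (g i).
  have mS := measurable_rescale x (h i.+1).
  exact: (measurableT_comp (measurable_expK intK (u * tilt n i)) mS).
have E o : expR (speed n * (u * (rke K h X n.+1 x o - f x))) =
    expR (- (speed n * (u * f x))) * \prod_(i < n.+1) g i (X i o).
  rewrite /g -expR_sum -expRD; congr expR.
  rewrite !mulrBr addrC; congr (_ + _).
  rewrite /rke !mulr_sumr; apply: eq_bigr => i _; rewrite /tilt.
  by rewrite invfM; ring.
under eq_integral do rewrite E EFinM.
have mprod : measurable_fun setT (EFin \o (fun o => \prod_(i < n.+1) g i (X i o))).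
  by apply/measurable_EFinP; exact: (measurable_prod_comp mX mg).
transitivity ((expR (- (speed n * (u * f x))))%:E *
    \int[P]_o (\prod_(i < n.+1) g i (X i o))%:E)%E.
  apply: ge0_integralZl => // o _.
  by rewrite lee_fin prodr_ge0// => i _; exact: expR_ge0.
rewrite (integral_prod_indep mX indX mg); last 2 first.
- by move=> i y; exact: expR_ge0.
- by move=> i; rewrite gE ltry.
under eq_bigr do rewrite gE.
rewrite prodEFin -EFinM; congr (_%:E).
rewrite /log_mgf mulrDr mulVKf ?gt_eqF ?speed_gt0// expRD mulrN.
congr (_ * _); rewrite expR_sum; apply: eq_bigr => i _.
by rewrite lnK// posrE one_sphi_gt0.
Qed.

Definition Lambda u : R := - (u * f x) + f x * ((1 - b) * Rpsi lam K a u).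

Lemma Lambda_ge0 u : 0 <= Lambda u.
Proof.
have := Rpsi_ge KM intK b0 u K1; rewrite ler_pdivrMr// => h1.
have := ler_wpM2l (f0 x) h1; rewrite /Lambda; lra.
Qed.

Lemma Lambda0 : Lambda 0 = 0.
Proof. by rewrite /Lambda Rpsi0 !mulr0 mul0r oppr0 addr0. Qed.

Lemma Lambda_derivable (u : R) : derivable Lambda u 1.
Proof.
have dR := derivableP (Rpsi_derivable KM intK b0 b1 (u := u)).
by rewrite /Lambda; exact: ex_derive.
Qed.

(* The average of the individual log-Laplace transforms is, up to a factor, a
   Riemann sum for the integral over [0, 1] defining [psi]. *)
Lemma mean_phi_riemann n u :
  (speed n)^-1 * \sum_(i < n.+1) h i.+1 ^+ d * phi lam K (u * tilt n i) =
  (rho b n)^-1 * (n.+1%:R^-1 * \sum_(i < n.+1)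
     psi_slice lam K a (u * ((1 - b) * rho b n)) (i.+1%:R / n.+1%:R)).
Proof.
rewrite !mulr_sumr; apply: eq_bigr => i _.
rewrite /psi_slice tiltE.
(* [psi_slice] divides its parameter by [1 - b], so [rho] is absorbed into a parameter that drifts
   with [n] and tends to [u]. *)
have -> : u * (rho b n * (i.+1%:R / n.+1%:R) `^ b) =
    (i.+1%:R / n.+1%:R) `^ b * (u * ((1 - b) * rho b n) / (1 - b)).
  by field; rewrite gt_eqF.
rewrite !mulrA; congr (_ * _).
have n1 (k : nat) (r : R) : k.+1%:R `^ r != 0 by rewrite gt_eqF// powR_gt0.
have NE : n.+1%:R `^ (1 - b) * n.+1%:R `^ b = n.+1%:R :> R.
  by rewrite -powRD ?subrK ?powRr1// implybE gt_eqF ?orbT.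
rewrite speed_psum hdE !powRN powR_div// /rho -[X in _ = _ / X * _]NE.
have cd0 : c ^+ d != 0 by rewrite expf_neq0// gt_eqF.
have ps0 : psum b n.+1 != 0 by rewrite gt_eqF// psum_gt0.
move: (n1 i b) (n1 n b) (n1 n (1 - b)) cd0 ps0.
move: (i.+1%:R `^ b) (n.+1%:R `^ b) (n.+1%:R `^ (1 - b)) (c ^+ d) (psum b n.+1).
move=> x1 x2 x3 x4 x5 h1 h2 h3 h4 h5; field.
by rewrite h1 h2 h3 h4 h5.
Qed.

(** The summed function itself changes with [n]. The Lipschitz bound, uniform in [s], freezes its
    parameter at [u], after which the fixed-function Riemann sum applies. *)
Lemma mean_phi_cvg u :
  (speed n)^-1 * \sum_(i < n.+1) h i.+1 ^+ d * phi lam K (u * tilt n i)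
  @[n --> \oo] --> (1 - b) * Rpsi lam K a u.
Proof.
under eq_fun do rewrite mean_phi_riemann.
apply: cvgM.
  rewrite (_ : (fun n => _) = (fun n => (1 - b) * ((1 - b) * rho b n)^-1)); last first.
    apply/funext => n; field.
    by apply/andP; split; rewrite gt_eqF// rho_gt0.
  rewrite [X in _ --> X](_ : _ = (1 - b) * 1^-1); last by rewrite invr1 mulr1.
  apply: cvgM; first exact: cvg_cst.
  by apply: cvgV; [exact: oner_neq0|exact: rho_cvg].
pose C := (1 - b)^-1 * expR (3 * (`|u| / (1 - b) * M)) * nK lam K.
pose un n := u * ((1 - b) * rho b n).
pose T v n := n.+1%:R^-1 * \sum_(i < n.+1) psi_slice lam K a v (i.+1%:R / n.+1%:R).
have c1 : T u n @[n --> \oo] --> Rpsi lam K a u.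
  apply: (@riemann_sum_nd _ _
    (`|u / (1 - b)| * expR (`|u / (1 - b)| * M) * nK lam K)).
  - move=> s t s0 st t1; apply: (psi_slice_nd KM intK b0) => //.
      by rewrite in_itv/= s0 (le_trans st).
    by rewrite in_itv/= t1 (lt_le_trans s0).
  - move=> s /andP[s0 s1]; have := psi_slice_norm KM intK b0 u (s := s).
    by rewrite s1 (ltW s0) => /(_ isT); rewrite ler_norml => /andP[].
  - exact: (integrable_psi_slice KM intK b0 u).
have un_le n : `|un n| <= `|u|.
  rewrite normrM -[leRHS]mulr1 ler_wpM2l// ger0_norm ?rho_le//.
  by rewrite mulr_ge0// ltW// rho_gt0.
have c2 : un n @[n --> \oo] --> u.
  by rewrite -[X in _ --> X]mulr1; apply: cvgM; [exact: cvg_cst|exact: rho_cvg].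
have dT n : `|T (un n) n - T u n| <= `|un n - u| * C.
  rewrite /T -mulrBr -sumrB normrM ger0_norm ?invr_ge0// ler_pdivrMl//.
  apply: le_trans (ler_norm_sum _ _ _) _.
  have -> : n.+1%:R * (`|un n - u| * C) = \sum_(i < n.+1) `|un n - u| * C.
    by rewrite sumr_const card_ord mulr_natl.
  apply: ler_sum => i _; apply: (psi_slice_lipschitz KM intK b0 b1) => //.
  by rewrite divr_gt0//= ler_pdivrMr// mul1r ler_nat.
have c3 : T (un n) n - T u n @[n --> \oo] --> (0 : R).
  apply/norm_cvg0P.
  apply: (@squeeze_cvgr _ _ _ _ (cst 0) (fun n => `|un n - u| * C)).
  - by apply: nearW => n; rewrite normr_ge0 dT.
  - exact: cvg_cst.
  - rewrite -[X in _ --> X](mul0r C); apply: cvgM; last exact: cvg_cst.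
    apply/norm_cvg0P; rewrite -[X in _ --> X](subrr u).
    by apply: cvgB => //; exact: cvg_cst.
rewrite -[X in _ --> X]add0r (_ : (fun n => _) =
    (fun n => (T (un n) n - T u n) + T u n)); last first.
  by apply/funext => n; rewrite subrK.
exact: cvgD.
Qed.

Lemma log_mgf_cvg u : log_mgf n u @[n --> \oo] --> Lambda u.
Proof.
pose B := `|u| * (1 - b)^-1.
have M0 : 0 <= M by exact: M_ge0 KM.
have Mf0 : 0 <= Mf by exact: Mf_ge0 f0 fM.
have nK0 := nK_ge0 lam K.
have B0 : 0 <= B by rewrite mulr_ge0// invr_ge0 ltW.
pose C1 := B * expR (B * M) * Mf * nK lam K.
have wB n i : (i < n.+1)%N -> `|u * tilt n i| <= B.
  by move=> lin; rewrite normrM ler_wpM2l// ger0_norm ?tilt_ge0// tilt_le.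
(* Error per unit weight [h i.+1 ^+ d], free of [n]: the first summand comes from linearising the
   logarithm, the second from the bias. *)
pose eta i := expR (B * M) * C1 ^+ 2 * h i.+1 ^+ d +
  B * expR (B * M) * kernel_bias lam K f x (h i.+1).
have kb0 r : 0 <= kernel_bias lam K f x r.
  by apply: Rintegral_ge0 => z _; rewrite mulr_ge0.
have step n i : (i < n.+1)%N ->
  `|ln (1 + h i.+1 ^+ d * sphi (h i.+1) (u * tilt n i)) -
    h i.+1 ^+ d * (f x * phi lam K (u * tilt n i))| <= h i.+1 ^+ d * eta i.
  move=> lin; have {}wB := wB _ _ lin; set w := u * tilt n i in wB *.
  set y := h i.+1 ^+ d * sphi (h i.+1) w.
  have hd0 := hd_gt0 i.
  have expB : `|w| * expR (`|w| * M) <= B * expR (B * M).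
    by apply: ler_pM => //; rewrite ?expR_ge0// ler_expR ler_wpM2r.
  have lny : `|ln (1 + y) - y| <= expR (B * M) * y ^+ 2.
    apply: ln1D_sub_le; apply: le_trans (_ : expR (- (`|w| * M)) <= _).
      by rewrite ler_expR lerN2 ler_wpM2r.
    by apply: (expectation_exp_kernel_ge lamP x KM intK mf f0 fM (mX 0) (Xf 0)); exact: h_gt0.
  have yC : `|y| <= h i.+1 ^+ d * C1.
    rewrite normrM (gtr0_norm hd0) ler_pM2l//.
    apply: le_trans (smoothed_phi_norm x KM intK mf f0 fM _ _) _.
    by rewrite /C1 ler_wpM2r// ler_wpM2r.
  have y2 : y ^+ 2 <= (h i.+1 ^+ d * C1) ^+ 2.
    rewrite -[leLHS]real_normK ?num_real// ler_sqr ?nnegrE//.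
    exact: le_trans yC.
  have yb : `|y - h i.+1 ^+ d * (f x * phi lam K w)| <=
      h i.+1 ^+ d * (B * expR (B * M) * kernel_bias lam K f x (h i.+1)).
    rewrite -mulrBr normrM (gtr0_norm hd0) ler_pM2l//.
    apply: le_trans (smoothed_phi_bias x KM intK mf f0 fM _ _) _.
    by rewrite ler_wpM2r.
  apply: le_trans (ler_distD y _ _) _.
  rewrite /eta mulrDr; apply: lerD => //.
  apply: le_trans lny _; apply: le_trans (ler_wpM2l (expR_ge0 _) y2) _.
  by rewrite le_eqVlt; apply/orP; left; apply/eqP; ring.
have eta0 : eta n @[n --> \oo] --> (0 : R).
  rewrite -[X in _ --> X]addr0; apply: cvgD.
    rewrite -[X in _ --> X](mulr0 (expR (B * M) * C1 ^+ 2)).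
    apply: cvgM; first exact: cvg_cst.
    rewrite (_ : (fun n => _) = (fun n => c ^+ d * (n.+1%:R `^ b)^-1)); last first.
      by apply/funext => n; rewrite hdE powRN.
    rewrite -[X in _ --> X](mulr0 (c ^+ d)); apply: cvgM; first exact: cvg_cst.
    by apply/gtr0_cvgV0; [apply: nearW => n; exact: powR_gt0|exact: powR_natr_cvgy].
  rewrite -[X in _ --> X](mulr0 (B * expR (B * M))); apply: cvgM; first exact: cvg_cst.
  by apply: (kernel_bias_cvg0 intK mf f0 fM fcont); exact: h_cvg0.
have ces : (speed n)^-1 * \sum_(i < n.+1) h i.+1 ^+ d * eta i @[n --> \oo] --> (0 : R).
  have := @weighted_cesaro R (fun i => h i.+1 ^+ d) eta hd_gt0.
  rewrite (_ : (fun n => \sum_(i < n.+1) h i.+1 ^+ d) = speed); last first.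
    by apply/funext => n; rewrite speedE.
  move=> /(_ speed_cvgy eta0).
  by under eq_fun do rewrite -speedE.
pose S n := (speed n)^-1 * \sum_(i < n.+1) h i.+1 ^+ d * phi lam K (u * tilt n i).
pose E n := (speed n)^-1 * \sum_(i < n.+1)
   ln (1 + h i.+1 ^+ d * sphi (h i.+1) (u * tilt n i)) - f x * S n.
have E0 : E n @[n --> \oo] --> (0 : R).
  apply/norm_cvg0P.
  apply: (@squeeze_cvgr _ _ _ _ (cst 0)
    (fun n => (speed n)^-1 * \sum_(i < n.+1) h i.+1 ^+ d * eta i)) => //.
  - apply: nearW => n; rewrite normr_ge0/=.
    have -> : E n = (speed n)^-1 * \sum_(i < n.+1)
        (ln (1 + h i.+1 ^+ d * sphi (h i.+1) (u * tilt n i)) -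
         h i.+1 ^+ d * (f x * phi lam K (u * tilt n i))).
      rewrite /E /S sumrB mulrBr; congr (_ - _); rewrite mulrCA; congr (_ * _).
      by rewrite mulr_sumr; apply: eq_bigr => i _; exact: mulrCA.
    rewrite normrM gtr0_norm ?invr_gt0 ?speed_gt0// ler_pM2l ?invr_gt0 ?speed_gt0//.
    apply: le_trans (ler_norm_sum _ _ _) _; apply: ler_sum => i _.
    exact: step.
  - exact: cvg_cst.
rewrite /log_mgf /Lambda; apply: cvgD; first exact: cvg_cst.
rewrite -[X in _ --> X]add0r (_ : (fun n => _) = (fun n => E n + f x * S n)); last first.
  by apply/funext => n; rewrite /E subrK.
apply: cvgD => //; apply: cvgM; first exact: cvg_cst.
exact: mean_phi_cvg.
Qed.

(** For [f x] nonzero the affine change in [t] matches the two suprema term by term at the same [u].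
    For [f x = 0] the function [Lambda] vanishes and its transform is infinite off 0. *)
Lemma Ix_legendre : Ix lam a K (f x) = legendre Lambda.
Proof.
apply/funext => t; rewrite /Ix; case: eqVneq => [fx0|fxn0] /=.
  have L0 u : Lambda u = 0 by rewrite /Lambda fx0 mulr0 mul0r oppr0 addr0.
  case: eqVneq => [->|t0].
    by rewrite legendre_0// ?Lambda0// => u; rewrite L0.
  (* The slope [A / t] gives the value [A], for arbitrary [A]. *)
  apply/esym/eqyP => A A0; have := legendre_ge Lambda (A / t) t.
  by rewrite L0 subr0 divfK.
have fx_gt0 : 0 < f x by rewrite lt_neqAle eq_sym fxn0 f0.
have k0 : 0 < f x * (1 - b) by rewrite mulr_gt0.
rewrite /Irate -ereal_sup_pZl// /legendre; congr ereal_sup.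
have E u : ((f x * (1 - b))%:E * ((u * ((1 - b)^-1 + t / (f x * (1 - b))))%:E -
    psi lam a K u) = (u * t - Lambda u)%:E)%E.
  rewrite (psiE lamP KM intK b0) -EFinB -EFinM /Lambda; congr (_%:E).
  by field; rewrite fxn0 gt_eqF.
apply/seteqP; split => y /=.
  by move=> [_ [u _ <-] <-]; exists u.
by move=> [u _ <-]; eexists; [exists u; reflexivity|].
Qed.

Lemma rke_ldp : LDP P (fun n o => rke K h X n.+1 x o - f x) speed
  (Ix lam a K (f x)).
Proof.
rewrite Ix_legendre; apply: (gartner_ellis_ldp (L := log_mgf)).
- exact: measurable_rke.
- exact: speed_gt0.
- exact: speed_nd.
- exact: speed_cvgy.
- exact: mgf_rke.
- exact: log_mgf_cvg.
- exact: Lambda_ge0.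
- exact: Lambda0.
- exact: Lambda_derivable.
Qed.

End recursive_estimator.

Theorem theorem1 (R : realType) (d : nat)
  (lam : {measure set (d.-tuple R) -> \bar R})
  (d0 : measure_display) (Omega : measurableType d0) (P : probability Omega R)
  (X : nat -> Omega -> d.-tuple R) (f : d.-tuple R -> R) (K : d.-tuple R -> R)
  (c a : R) (h : nat -> R) (x : d.-tuple R) :
  (0 < d)%N ->
  is_lebesgue_tuple lam ->
  (* X_1, X_2, ... (= X 0, X 1, ...) i.i.d. with bounded density f *)
  (forall i, measurable_fun setT (X i)) ->
  mutually_independent P X ->
  measurable_fun setT f -> (forall z, 0 <= f z) -> (exists M : R, forall z, f z <= M) ->
  (forall i, has_density P lam (X i) f) ->
  (* (H1) *)
  kernel_H1 lam K ->
  (* (H2) *)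
  0 < c -> 0 < a -> a < d%:R^-1 ->
  (forall n, (0 < n)%N -> h n = c * n%:R `^ (- a)) ->
  (* f continuous at x *)
  continuous_at_tuple f x ->
  (* the sequence (f_n(x) - f(x))_{n >= 1}, reindexed from 0 *)
  LDP P (fun n w => rke K h X n.+1 x w - f x)
        (fun n => \sum_(1 <= i < n.+2) h i ^+ d)
        (Ix lam a K (f x)).
Proof.
move=> d_gt0 lamP mX indX mf f0 [Mf fM] Xf [[M KM] intK K1 _] c0 a0 ad hE fcont.
have dR : (0 : R) < d%:R by rewrite ltr0n.
have b0 : 0 < a * d%:R by rewrite mulr_gt0.
have b1 : a * d%:R < 1 by rewrite -ltr_pdivlMr// div1r.
apply: (rke_ldp (M := M) (Mf := Mf) (c := c)) => //.
by rewrite /Rintegral K1.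
Qed.
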